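(* Let $\mathcal{P}$ be a family of probability distributions on a common measurable space with $\mathsf{D}_{\chi^2}(\mathcal{P})<\infty$, let $n\ge2$, let $P_1,\dots,P_n\in\mathcal{P}$, let $P_1'\in\mathcal{P}$ be arbitrary, and set $P_i'=P_i$ for all $i\ge2$. Define $\mathbb{P}_n=\mathbb{E}_{\pi\sim\mathrm{Unif}(S_n)}\left[\otimes_{i=1}^nP_{\pi(i)}\right]$, $\mathbb{P}_n'=\mathbb{E}_{\pi\sim\mathrm{Unif}(S_n)}\left[\otimes_{i=1}^nP'_{\pi(i)}\right]$ and $\overline{P}=\frac{1}{n-1}\sum_{i=2}^nP_i$. Then $$\mathrm{TV}(\mathbb{P}_n,\mathbb{P}_n')^2\le\frac14\int\frac{(\mathrm{d}\mathbb{P}_n-\mathrm{d}\mathbb{P}_n')^2}{\mathrm{d}\overline{P}^{\otimes n}}\le\frac{3\,\mathsf{D}_{\chi^2}(\mathcal{P})\left(e\,\mathsf{\Delta}_{H^2}(\mathcal{P})\right)^{3\mathsf{C}_{\chi^2}(\mathcal{P})}}{n}.$$ In particular, for every test function $f\in L^2(\overline{P}^{\otimes n})$, $$\left(\mathbb{E}_{\mathbb{P}_n}[f]-\mathbb{E}_{\mathbb{P}_n'}[f]\right)^2\le\mathbb{E}_{\overline{P}^{\otimes n}}[f^2]\cdot\frac{12\,\mathsf{D}_{\chi^2}(\mathcal{P})\left(e\,\mathsf{\Delta}_{H^2}(\mathcal{P})\right)^{3\mathsf{C}_{\chi^2}(\mathcal{P})}}{n}.$$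
   Context: $S_n$ is the permutation group of $\{1,\dots,n\}$. For probability measures $P,Q$ on the same space, $\mathrm{TV}(P,Q)=\frac12\int|\mathrm{d}P-\mathrm{d}Q|$, $\chi^2(P\|Q)=\int\frac{(\mathrm{d}P-\mathrm{d}Q)^2}{\mathrm{d}Q}$, $H^2(P,Q)=\int(\sqrt{\mathrm{d}P}-\sqrt{\mathrm{d}Q})^2$. For the family $\mathcal{P}$: $\mathsf{D}_{\chi^2}(\mathcal{P})=\sup_{P_1,P_2\in\mathcal{P}}\chi^2(P_1\|P_2)$; $\mathsf{C}_{\chi^2}(\mathcal{P})=\sup_{\rho}\mathbb{E}_{P\sim\rho}\left[\chi^2\left(P\,\|\,\mathbb{E}_{P'\sim\rho}[P']\right)\right]$ over all probability distributions (priors) $\rho$ on $\mathcal{P}$; $\mathsf{\Delta}_{H^2}(\mathcal{P})=\left(1-\frac12\sup_{P_1,P_2\in\mathcal{P}}H^2(P_1,P_2)\right)^{-2}$. *)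

(* Defs.v *)
From HB Require Import structures.
From mathcomp Require Import all_boot all_order all_algebra all_fingroup.
From mathcomp Require Import all_classical all_reals all_analysis.
From mathcomp Require Import measurable_realfun.

Set Implicit Arguments.
Unset Strict Implicit.
Unset Printing Implicit Defensive.

Import Order.TTheory GRing.Theory Num.Theory.
Import numFieldNormedType.Exports.

Local Open Scope classical_set_scope.
Local Open Scope ring_scope.
Local Open Scope ereal_scope.

(* The sum of finite measures is finite; the library only provides the        *)
(* measure structure on [measure_add].                                        *)
Section finite_measure_add.
Context d (T : measurableType d) (R : realType).
Variables m1 m2 : {finite_measure set T -> \bar R}.

Let measure_add_fin : fin_num_fun (measure_add m1 m2).
Proof. by move=> A mA; rewrite measure_addE fin_numD !fin_num_measure. Qed.

HB.instance Definition _ := Measure.on (measure_add m1 m2).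
HB.instance Definition _ :=
  @Measure_isFinite.Build _ _ _ (measure_add m1 m2) measure_add_fin.
End finite_measure_add.

(* An integral such as \int (dP - dQ)^2 / dL is the integral of the same      *)
(* expression in the densities of P, Q and L with respect to a common         *)
(* dominating measure. The expressions below are homogeneous of degree 1, so  *)
(* the dominating measure is immaterial; we take the sum of the measures      *)
(* involved.                                                                  *)
Section divergences.
Context d (T : measurableType d) (R : realType).
Implicit Types P Q L M : {finite_measure set T -> \bar R}.

Definition density P M (x : T) : R :=
  fine (Radon_Nikodym (charge_of_finite_measure P) M x).

Definition TV P Q : \bar R :=
  let M : {finite_measure set T -> \bar R} := measure_add P Q in
  2^-1%:E * \int[M]_x `|density P M x - density Q M x|%:E.

Definition hellinger2 P Q : \bar R :=
  let M : {finite_measure set T -> \bar R} := measure_add P Q in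
  \int[M]_x ((Num.sqrt (density P M x) - Num.sqrt (density Q M x)) ^+ 2)%:E.

(* \int (dP - dQ)^2 / dL; division in [\bar R] satisfies 0 / 0 = 0 and        *)
(* a / 0 = +oo for a > 0, which are the usual conventions.                    *)
Definition int_sqdiff P Q L : \bar R :=
  let M : {finite_measure set T -> \bar R} :=
    measure_add (measure_add P Q) L in
  \int[M]_x (((density P M x - density Q M x) ^+ 2)%:E / (density L M x)%:E).

Definition chi2 P Q : \bar R := int_sqdiff P Q Q.

End divergences.

(* E_{i ~ Unif(I)}[P i]; the first argument only witnesses that I is nonempty *)
Definition unif_mixture d (T : measurableType d) (R : realType) (I : finType)
    (_ : I) (P : I -> probability T R) : set T -> \bar R :=
  fun A => (#|I|%:R^-1)%:E * \sum_(i : I) P i A.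

Section unif_mixture_probability.
Context d (T : measurableType d) (R : realType) (I : finType).
Variables (i0 : I) (P : I -> probability T R).

Let mix0 : unif_mixture i0 P set0 = 0.
Proof. by rewrite /unif_mixture big1 ?mule0. Qed.

Let mix_ge0 A : 0 <= unif_mixture i0 P A.
Proof. by rewrite mule_ge0 ?lee_fin ?invr_ge0// sume_ge0. Qed.

Let mix_sigma_additive : semi_sigma_additive (unif_mixture i0 P).
Proof.
move=> F mF tF mUF; rewrite /unif_mixture.
rewrite [X in X @ _ --> _](_ : _ = (fun n => (#|I|%:R^-1)%:E *
    \sum_(i : I) \sum_(0 <= k < n) P i (F k))); last first.
  apply/funext => n; rewrite exchange_big/= ge0_sume_distrr// => k _.
  exact: sume_ge0.
apply: cvgeZl => //; apply: cvg_nnesum => i _.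
  by apply: nearW => n; exact: sume_ge0.
exact: measure_semi_sigma_additive.
Qed.

HB.instance Definition _ := isMeasure.Build _ _ _ (unif_mixture i0 P)
  mix0 mix_ge0 mix_sigma_additive.

Let mix_setT : unif_mixture i0 P [set: T] = 1.
Proof.
rewrite /unif_mixture; under eq_bigr do rewrite probability_setT.
have I0 : (0 < #|I|)%N by apply/card_gt0P; exists i0.
rewrite sumEFin -EFinM big_const iter_addr addr0 mulVf// pnatr_eq0.
by rewrite -lt0n.
Qed.

HB.instance Definition _ :=
  Measure_isProbability.Build _ _ _ (unif_mixture i0 P) mix_setT.
End unif_mixture_probability.

(* E_{t ~ rho}[k t] *)
Definition mixture d d' (S : measurableType d) (T : measurableType d')
    (R : realType) (rho : probability S R) (k : S -> pprobability T R)
    (mk : measurable_fun [set: S] k) : set T -> \bar R :=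
  fun A => \int[rho]_t kprobability mk t A.

Section mixture_probability.
Context d d' (S : measurableType d) (T : measurableType d') (R : realType).
Variables (rho : probability S R) (k : S -> pprobability T R).
Variable mk : measurable_fun [set: S] k.

Let mix0 : mixture rho mk set0 = 0.
Proof. by apply: integral0_eq => t _; rewrite measure0. Qed.

Let mix_ge0 A : 0 <= mixture rho mk A.
Proof. by apply: integral_ge0 => t _; exact: measure_ge0. Qed.

Let mix_sigma_additive : semi_sigma_additive (mixture rho mk).
Proof.
move=> F mF tF mUF.
rewrite [X in _ --> X](_ : _ = \sum_(n <oo) mixture rho mk (F n)).
  by apply/cvg_closeP; split; [exact: is_cvg_nneseries|rewrite closeE].
rewrite /mixture -integral_nneseries//; last first.
  by move=> n; exact: measurable_kernel.
apply: eq_integral => t _; apply/esym/cvg_lim => //.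
exact: measure_semi_sigma_additive.
Qed.

HB.instance Definition _ := isMeasure.Build _ _ _ (mixture rho mk)
  mix0 mix_ge0 mix_sigma_additive.

Let mix_setT : mixture rho mk [set: T] = 1.
Proof.
rewrite /mixture (eq_integral (cst 1)); last first.
  by move=> t _; exact: (probability_setT (k t : probability T R)).
by rewrite integral_cst// mul1e; exact: probability_setT.
Qed.

HB.instance Definition _ :=
  Measure_isProbability.Build _ _ _ (mixture rho mk) mix_setT.
End mixture_probability.

Section product_probability.
Context d (T : measurableType d) (R : realType).

Definition pair_cons n (z : T * n.-tuple T) : n.+1.-tuple T :=
  [the n.+1.-tuple T of z.1 :: z.2].

Let measurable_pair_cons n : measurable_fun [set: _] (@pair_cons n).
Proof. by apply: measurable_cons. Qed.

HB.instance Definition _ n :=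
  isMeasurableFun.Build _ _ _ _ (@pair_cons n) (@measurable_pair_cons n).

Fixpoint tuple_product n : ('I_n -> probability T R) ->
    probability (n.-tuple T) R :=
  match n with
  | 0%N => fun=> (\d_ [tuple] : probability (0.-tuple T) R)
  | n'.+1 => fun P =>
      distribution (P ord0 \x tuple_product (fun i => P (lift ord0 i)))
        (@pair_cons n')
  end.

Lemma tuple_product_box n (P : 'I_n -> probability T R) (A : 'I_n -> set T) :
  (forall i, measurable (A i)) ->
  tuple_product P [set t | forall i, A i (tnth t i)] = \prod_(i < n) P i (A i).
Proof.
elim: n P A => [|n IH] P A mA /=.
  rewrite big_ord0 diracE mem_set//= => -[]//.
rewrite big_ord_recl -IH// -product_measure1E//; last first.
  rewrite [X in measurable X](_ : _ =
      \bigcap_(i in [set: 'I_n]) ((@tnth _ T)^~ i @^-1` A (lift ord0 i))).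
    apply: fin_bigcap_measurable => // i _.
    by rewrite -[X in measurable X]setTI; exact: measurable_tnth.
  by apply/seteqP; split => t /= h i; [move=> _; exact: h|exact: (h i I)].
congr (product_measure1 _ _ _); apply/seteqP; split => -[x t] /= h.
  split; first by have := h ord0; rewrite tnth0.
  by move=> i; have := h (lift ord0 i); rewrite tnthS.
case: h => h0 h i; case: (unliftP ord0 i) => [j ->|->].
  by rewrite tnthS; exact: h.
by rewrite tnth0.
Qed.

End product_probability.

(* E_{pi ~ Unif(S_n)}[P_{pi 1} (x) ... (x) P_{pi n}] *)
Definition perm_mixture d (T : measurableType d) (R : realType) n
    (P : 'I_n -> probability T R) : probability (n.-tuple T) R :=
  unif_mixture (1%g : 'S_n) (fun s : 'S_n => tuple_product (fun i => P (s i))).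

Section family_parameters.
Context d (T : measurableType d) (R : realType).
Variable F : set (probability T R).

Definition chi2_diameter : \bar R :=
  ereal_sup [set chi2 P Q | P in F & Q in F].

(* A prior on F is presented as the law of a random element k of F defined on *)
(* a probability space (S, rho). Quantifying over S amounts to allowing every *)
(* sigma-algebra on F that makes the evaluations P |-> P A measurable. The    *)
(* last measurability condition is what makes the expectation meaningful.     *)
Definition chi2_capacity : \bar R :=
  ereal_sup [set v | exists d' (S : measurableType d') (rho : probability S R)
    (k : S -> pprobability T R) (mk : measurable_fun [set: S] k),
    [/\ forall t, F (k t),
        measurable_fun [set: S]
          (fun t => chi2 (k t : probability T R) (mixture rho mk)) &
        v = \int[rho]_t chi2 (k t : probability T R) (mixture rho mk)]].

Definition hellinger_delta : \bar R :=
  (1 - 2^-1%:E * ereal_sup [set hellinger2 P Q | P in F & Q in F])^-1 ^+ 2.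

End family_parameters.

(* x to the power y, for x in [1, +oo] and y in [0, +oo] *)
Definition epow (R : realType) (x y : \bar R) : \bar R := expeR (y * lne x).

(* Main.v *)
(* Let m = n - 1 and let g, f_2, ..., f_n be the densities of P_1 - P_1', P_2,
   ..., P_n with respect to Pbar. Expanding the square, the integral of
   (dP_n - dP_n')^2 / dPbar^n is 1/n! times the permanent of the Gram matrix of
   (g, f_2, ..., f_n) in L^2(Pbar).

   A permanent of a Gram matrix <v_i, v_j> is the squared norm of the product of
   the linear forms v_i in the space of polynomials where X^a has squared norm
   a! (Wick's formula). There, multiplication by a linear form is adjoint to the
   derivative along it. Write f_i = 1 + w_i; the w_i sum to zero. Let X_0 be the
   variable of the constant function 1, a_t the squared norm of the component of
   degree t in the w_i of prod (X_0 + w_i), divided by m!, and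
   F(s) = sum_t s^t a_t, which is the analogous quantity for
   prod (X_0 + sqrt s w_i).
   - Multiplying by g gives at most |g|^2 m! sum_t (1 + t) a_t. With
     s = 2 - lam and delta = 1 / (1 - lam) this is at most |g|^2 m! delta F(s),
     as 1 + t <= delta s^t.
   - An AM-GM inequality for the norm bounds F(s) by the average of its values
     over all maps i : [m] -> [m], and the latter is at most
     sum_t s^t prod_(u < t) (C + u lam) / (u + 1) <= (1 - s lam)^(- C / lam),
     where C = (1/m) sum |w_i|^2 and lam bounds the operator (1/m) sum w_i w_i^T.
   - Since (1 - s lam) = (1 - lam)^2, everything is at most (e delta)^(3 C) as
     soon as lam <= C.
   Finally C is at most the chi^2 capacity, lam may be taken to be the minimum of
   C and 1 - min <f_i, f_j>, and <f_i, f_j> is at least the squared affinity of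
   P_i and P_j; convexity gives |g|^2 <= 4 D. *)

Require Import Defs.
From HB Require Import structures.
From mathcomp Require Import all_boot all_order all_algebra all_fingroup.
From mathcomp Require Import ring lra.
From mathcomp Require mpoly.

Set Implicit Arguments.
Unset Strict Implicit.
Unset Printing Implicit Defensive.

(** * Permanents and the polynomial Fock space *)

(* The notations of [mpoly] clash with those of MathComp-Analysis, so they are
   confined to this module. *)
Module Fock.
Import mpoly.
Import Order.TTheory GRing.Theory Num.Theory.
Local Open Scope ring_scope.

(** * The Fischer inner product on polynomials, with multiplication and derivation as adjoint
    operators *)

Section dot.
Variables (R : realFieldType) (k : nat).
Implicit Types (p q : {mpoly R[k]}) (v u : 'I_k -> R).

Definition mfact (m : 'X_{1..k}) : nat := \prod_(i < k) (m i)`!.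

Lemma mfactD1 m r : mfact (m + U_(r))%MM = ((m r).+1 * mfact m)%N.
Proof.
rewrite /mfact (bigD1 r)//= [in RHS](bigD1 r)//= mnmDE mnm1E eqxx addn1 factS.
rewrite mulnA; congr muln; apply: eq_bigr => i ir.
by rewrite mnmDE mnm1E eq_sym (negbTE ir) addn0.
Qed.

(** Fischer (or Bombieri) inner product: monomials are orthogonal and ['X_[m]] has squared norm
    [mfact m]. Summing over the support of [p] alone loses nothing but hides the symmetry, which
    [dotC] recovers. *)
Definition dot p q : R := \sum_(m <- msupp p) p@_m * q@_m * (mfact m)%:R.
Definition normsq p := dot p p.

(** Coefficients vanish off the support, so any longer duplicate-free list will do; this puts
    several polynomials on one list of monomials. *)
Lemma dotE s p q : uniq s -> {subset msupp p <= s} ->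
  dot p q = \sum_(m <- s) p@_m * q@_m * (mfact m)%:R.
Proof.
move=> us ps; rewrite (bigID (mem (msupp p)))/= [X in _ + X]big1 ?addr0; last first.
  by move=> m; rewrite mcoeff_msupp negbK => /eqP ->; rewrite !mul0r.
rewrite -big_filter; apply: perm_big; apply: uniq_perm => //.
  exact: filter_uniq.
by move=> m; rewrite mem_filter andb_idr// => /ps.
Qed.

Lemma dotC p q : dot p q = dot q p.
Proof.
rewrite (@dotE (undup (msupp p ++ msupp q)) p) ?undup_uniq//; last first.
  by move=> m mp; rewrite mem_undup mem_cat mp.
rewrite (@dotE (undup (msupp p ++ msupp q)) q) ?undup_uniq//; last first.
  by move=> m mp; rewrite mem_undup mem_cat mp orbT.
by apply: eq_bigr => m _; rewrite (mulrC p@_m).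
Qed.

Lemma dotDr p q1 q2 : dot p (q1 + q2) = dot p q1 + dot p q2.
Proof. by rewrite -big_split; apply: eq_bigr => m _ /=; rewrite mcoeffD; ring. Qed.

Lemma dotZr p c q : dot p (c *: q) = c * dot p q.
Proof. by rewrite mulr_sumr; apply: eq_bigr => m _; rewrite mcoeffZ; ring. Qed.

Lemma dotDl p1 p2 q : dot (p1 + p2) q = dot p1 q + dot p2 q.
Proof. by rewrite dotC dotDr !(dotC q). Qed.

Lemma dotZl c p q : dot (c *: p) q = c * dot p q.
Proof. by rewrite dotC dotZr dotC. Qed.

Lemma dot0r p : dot p 0 = 0.
Proof. by rewrite -(scale0r 0) dotZr mul0r. Qed.

Lemma dotNr p q : dot p (- q) = - dot p q.
Proof. by rewrite -scaleN1r dotZr mulN1r. Qed.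

Lemma dotNl p q : dot (- p) q = - dot p q.
Proof. by rewrite dotC dotNr dotC. Qed.

Lemma dot_sumr (I : Type) (r : seq I) (P : pred I) (F : I -> {mpoly R[k]}) p :
  dot p (\sum_(i <- r | P i) F i) = \sum_(i <- r | P i) dot p (F i).
Proof. by elim/big_rec2: _ => [|i x y _ <-]; rewrite ?dot0r ?dotDr. Qed.

Lemma dot_suml (I : Type) (r : seq I) (P : pred I) (F : I -> {mpoly R[k]}) p :
  dot (\sum_(i <- r | P i) F i) p = \sum_(i <- r | P i) dot (F i) p.
Proof. by rewrite dotC dot_sumr; apply: eq_bigr => i _; rewrite dotC. Qed.

Lemma normsqE s p : uniq s -> {subset msupp p <= s} ->
  normsq p = \sum_(m <- s) p@_m ^+ 2 * (mfact m)%:R.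
Proof. by move=> us ps; rewrite /normsq (dotE _ us ps). Qed.

Lemma normsq_ge0 p : 0 <= normsq p.
Proof.
by rewrite (@normsqE (msupp p))// sumr_ge0// => m _; rewrite mulr_ge0// sqr_ge0.
Qed.

Lemma normsqD p q : normsq (p + q) = normsq p + 2 * dot p q + normsq q.
Proof. by rewrite /normsq dotDl !dotDr (dotC q p); ring. Qed.

Lemma normsqB p q : normsq (p - q) = normsq p - 2 * dot p q + normsq q.
Proof. by rewrite normsqD dotNr /normsq dotNl dotNr; ring. Qed.

Lemma normsqZ c p : normsq (c *: p) = c ^+ 2 * normsq p.
Proof. by rewrite /normsq dotZl dotZr mulrA. Qed.

Lemma normsq1 : normsq 1 = 1.
Proof.
by rewrite /normsq /dot msupp1 big_seq1 mcoeff1 eqxx /mfact big1 ?mulr1// => i _; rewrite mnm0E.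
Qed.

Lemma dotXm m q : dot 'X_[m] q = q@_m * (mfact m)%:R.
Proof. by rewrite /dot msuppX big_seq1 mcoeffX eqxx mul1r. Qed.

(** On monomials this is the identity (m + U_r)! = (m_r + 1) m!, recorded in [mfactD1]. *)
Lemma dot_mulX r p q : dot ('X_r * p) q = dot p (mderiv r q).
Proof.
rewrite (mpolyE p) mulr_sumr !dot_suml; apply: eq_bigr => m _.
rewrite -scalerAr !dotZl -mpolyXD !dotXm mcoeff_deriv addmC mfactD1.
by rewrite natrM -mulr_natr; ring.
Qed.

Definition lin v : {mpoly R[k]} := \sum_r v r *: 'X_r.
Definition der v q : {mpoly R[k]} := \sum_r v r *: mderiv r q.
Definition ip v u : R := \sum_r v r * u r.

Lemma ipC v u : ip v u = ip u v.
Proof. by apply: eq_bigr => r _; rewrite mulrC. Qed.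

Lemma dot_mul_lin v p q : dot (lin v * p) q = dot p (der v q).
Proof.
rewrite /lin /der mulr_suml dot_suml dot_sumr; apply: eq_bigr => r _.
by rewrite -scalerAl dotZl dotZr dot_mulX.
Qed.

Lemma derM v p q : der v (p * q) = der v p * q + p * der v q.
Proof.
rewrite /der mulr_suml mulr_sumr -big_split; apply: eq_bigr => r _ /=.
by rewrite mderivM scalerDr scalerAl scalerAr.
Qed.

Lemma derD v p q : der v (p + q) = der v p + der v q.
Proof. by rewrite /der -big_split; apply: eq_bigr => r _ /=; rewrite mderivD scalerDr. Qed.

Lemma derZ v c p : der v (c *: p) = c *: der v p.
Proof.
by rewrite /der scaler_sumr; apply: eq_bigr => r _; rewrite mderivZ !scalerA mulrC.
Qed.

Lemma der0 v : der v 0 = 0.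
Proof. by rewrite -(scale0r 0) derZ !scale0r. Qed.

Lemma der_sum v (I : Type) (r : seq I) (P : pred I) (F : I -> {mpoly R[k]}) :
  der v (\sum_(i <- r | P i) F i) = \sum_(i <- r | P i) der v (F i).
Proof. by elim/big_rec2: _ => [|i x y _ <-]; rewrite ?der0 ?derD. Qed.

Lemma mderiv_var (i j : 'I_k) : mderiv i ('X_j : {mpoly R[k]}) = (i == j)%:R.
Proof.
rewrite mderivX mnm1E eq_sym; case: eqVneq => [->|_]; last by rewrite scale0r.
rewrite scale1r -mpolyX0; congr 'X_[_].
by apply/mnmP => l; rewrite mnmBE subnn mnm0E.
Qed.

Lemma der_lin v u : der v (lin u) = (ip v u)%:A.
Proof.
rewrite /lin der_sum /ip scaler_suml; apply: eq_bigr => r _.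
rewrite derZ /der (bigD1 r)//= mderiv_var eqxx big1 ?addr0.
  by rewrite scalerA mulrC.
by move=> s sr; rewrite mderiv_var (negbTE sr) scaler0.
Qed.

Lemma der_lin_mul v u q : der v (lin u * q) = ip v u *: q + lin u * der v q.
Proof. by rewrite derM der_lin mulr_algl. Qed.

(** The commutation relation [der_lin_mul] paired with [q]: the commutator gives the first term, and
    adjointness turns the other into a squared norm. *)
Lemma normsq_lin_mul v q : normsq (lin v * q) = ip v v * normsq q + normsq (der v q).
Proof.
by rewrite /normsq dot_mul_lin der_lin_mul dotDr dotZr dotC [in X in _ + X]dot_mul_lin.
Qed.

Lemma dot_lin2 v w q : normsq (lin v * (lin w * q)) =
  ip v w * dot (lin v * q) (lin w * q) + dot (der v (lin v * q)) (der w (lin w * q)).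
Proof.
have e : lin v * (lin w * q) = lin w * (lin v * q) by rewrite mulrCA.
rewrite /normsq {1}e dot_mul_lin der_lin_mul dotDr dotZr (ipC w); congr (_ + _).
by rewrite dotC dot_mul_lin dotC.
Qed.

(* The two sides differ by the squared norm of [der v (v q) - der w (w q)]
   plus the sum over [b] of the squared norms of [v_b v q - w_b w q]; this is
   the positivity of the integral of [(|z_v|^2 - |z_w|^2)^2 |q|^2] against a
   complex Gaussian measure. *)
Lemma normsq_lin2_le v w q : 2 * normsq (lin v * (lin w * q)) <=
  normsq (lin v * (lin v * q)) + normsq (lin w * (lin w * q)).
Proof.
have h1 := normsq_ge0 (der v (lin v * q) - der w (lin w * q)).
have h2 : 0 <= \sum_b normsq (v b *: (lin v * q) - w b *: (lin w * q)).
  by apply: sumr_ge0 => b _; exact: normsq_ge0.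
have e2 : \sum_b normsq (v b *: (lin v * q) - w b *: (lin w * q)) =
    ip v v * normsq (lin v * q) - 2 * ip v w * dot (lin v * q) (lin w * q)
    + ip w w * normsq (lin w * q).
  rewrite /ip mulr_sumr !mulr_suml -sumrB -big_split/=; apply: eq_bigr => b _.
  by rewrite normsqB !normsqZ dotZl dotZr; ring.
rewrite e2 in h2; rewrite normsqB in h1; rewrite dot_lin2 !normsq_lin_mul.
move: h1 h2; rewrite !normsq_lin_mul; lra.
Qed.

Lemma euler d p : p \is d.-homog -> \sum_r 'X_r * mderiv r p = d%:R *: p.
Proof.
move=> /dhomogP hp; rewrite [in RHS](mpolyE p) scaler_sumr.
under eq_bigr do rewrite {1}(mpolyE p) raddf_sum mulr_sumr.
rewrite exchange_big/= big_seq [RHS]big_seq; apply: eq_bigr => m /hp hm.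
have <- : mdeg m = d by rewrite -hm.
rewrite scalerA mulrC -scalerA mdegE natr_sum scaler_suml scaler_sumr.
apply: eq_bigr => r _.
rewrite mderivZ -scalerAr mderivX -scalerAr -mpolyXD; congr (_ *: _).
(* Subtraction of multi-indices is truncated, so m - U_r + U_r = m only when m_r > 0; otherwise both
   sides carry the coefficient 0. *)
have [->|mr0] := eqVneq (m r) 0%N; first by rewrite !scale0r.
congr (_ *: 'X_[_]); apply/mnmP => j; rewrite mnmDE mnmBE mnm1E.
by case: eqVneq => [<-|_]; rewrite ?subn0// subnKC// lt0n.
Qed.

(** Euler's identity paired with [p], each variable being moved across as a derivative. *)
Lemma sum_normsq_mderiv d p : p \is d.-homog ->
  \sum_r normsq (mderiv r p) = d%:R * normsq p.
Proof.
move=> hp; rewrite -[d%:R * _]dotZl -(euler hp) dot_suml.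
by apply: eq_bigr => r _; rewrite dot_mulX.
Qed.

(** Monomials are orthogonal, so the bound splits over the monomials [m]; for each it is the
    hypothesis at the vector of the coefficients of the [q r] at [m]. *)
Lemma sum_normsq_lincomb_le (I : finType) (w : I -> 'I_k -> R) (L : R)
    (q : 'I_k -> {mpoly R[k]}) :
  (forall y, \sum_i ip (w i) y ^+ 2 <= L * ip y y) ->
  \sum_i normsq (\sum_r w i r *: q r) <= L * \sum_r normsq (q r).
Proof.
move=> hL; set s := undup (flatten [seq msupp (q r) | r <- enum 'I_k]).
have us : uniq s by exact: undup_uniq.
have qs r : {subset msupp (q r) <= s}.
  move=> m mq; rewrite mem_undup; apply/flattenP.
  by exists (msupp (q r)) => //; apply: map_f; rewrite mem_enum.
have ws i : {subset msupp (\sum_r w i r *: q r) <= s}.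
  move=> m; apply: contraTT => ms; rewrite mcoeff_msupp negbK raddf_sum/=.
  rewrite big1// => r _; rewrite mcoeffZ memN_msupp_eq0 ?mulr0//.
  by apply: contra ms; exact: qs.
under eq_bigr do rewrite (normsqE us (ws _)).
under [X in _ <= _ * X]eq_bigr do rewrite (normsqE us (qs _)).
rewrite exchange_big/= [X in _ <= _ * X]exchange_big/= mulr_sumr.
apply: ler_sum => m _; rewrite -!mulr_suml mulrA ler_wpM2r//.
have := hL (fun r => (q r)@_m).
have -> : ip (fun r => (q r)@_m) (fun r => (q r)@_m) = \sum_r (q r)@_m ^+ 2.
  by apply: eq_bigr => r _; rewrite expr2.
congr (_ <= _); apply: eq_bigr => i _; congr (_ ^+ 2).
by rewrite raddf_sum; apply: eq_bigr => r _ /=; rewrite mcoeffZ.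
Qed.

Lemma cauchy_schwarz_sum (v u : 'I_k -> R) : ip v u ^+ 2 <= ip v v * ip u u.
Proof.
suff e : \sum_r \sum_s (v r * u s - v s * u r) ^+ 2 =
    2 * (ip v v * ip u u - ip v u ^+ 2).
  rewrite -subr_ge0 -(pmulr_rge0 _ (ltr0n R 2)) -e.
  by apply: sumr_ge0 => r _; apply: sumr_ge0 => s _; exact: sqr_ge0.
have h (a b : 'I_k -> R) : (\sum_r a r) * (\sum_s b s) = \sum_r \sum_s a r * b s.
  by rewrite mulr_suml; apply: eq_bigr => r _; rewrite mulr_sumr.
have -> : 2 * (ip v v * ip u u - ip v u ^+ 2) =
  ip v v * ip u u + ip u u * ip v v - 2 * (ip v u * ip v u) by ring.
rewrite /ip !h mulr_sumr -big_split/= -sumrB.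
apply: eq_bigr => r _; rewrite mulr_sumr -big_split/= -sumrB.
by apply: eq_bigr => s _; ring.
Qed.

(** The one-vector case of [sum_normsq_lincomb_le], indexed by [unit]; its hypothesis is then
    Cauchy-Schwarz. *)
Lemma normsq_der_le d v p : p \is d.-homog -> normsq (der v p) <= ip v v * (d%:R * normsq p).
Proof.
move=> hp; rewrite -(sum_normsq_mderiv hp).
have := @sum_normsq_lincomb_le unit (fun=> v) (ip v v) (fun r => mderiv r p).
rewrite big_const card_unit/= addr0; apply => y.
by rewrite big_const card_unit/= addr0; exact: cauchy_schwarz_sum.
Qed.

End dot.

(** * Squared norms of products, summed over all choices of the factors *)

Section iterated.
Variables (R : realFieldType) (k : nat) (I : finType).
Implicit Types (p q : {mpoly R[k]}) (L : I -> {mpoly R[k]}).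

(* The sum of the squared norms of [L (i 1) * ... * L (i j) * q] over all maps
   [i] from [{1, ..., j}] to [I]. *)
Fixpoint itnorm L j q : R :=
  if j is j'.+1 then \sum_i itnorm L j' (L i * q) else normsq q.

Lemma itnorm_lin2_le L j v w q : 2 * itnorm L j (lin v * (lin w * q)) <=
  itnorm L j (lin v * (lin v * q)) + itnorm L j (lin w * (lin w * q)).
Proof.
elim: j q => [|j IH] q /=; first exact: normsq_lin2_le.
rewrite mulr_sumr -big_split; apply: ler_sum => i _ /=.
by rewrite !(mulrCA (L i)).
Qed.

(** The cross terms are linear in [w i], so they cancel once summed over [i]; the spare factors [L]
    commute with the rest and are merely carried along. *)
Lemma itnorm_sum_shift L j (p q : {mpoly R[k]}) (w : I -> {mpoly R[k]}) (a : R) :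
  \sum_i w i = 0 ->
  \sum_i itnorm L j ((p + a *: w i) * q) =
  #|I|%:R * itnorm L j (p * q) + a ^+ 2 * \sum_i itnorm L j (w i * q).
Proof.
move=> w0; elim: j q => [|j IH] q /=; last first.
  rewrite exchange_big/= [X in _ = _ + _ * X]exchange_big/= !mulr_sumr -big_split/=.
  apply: eq_bigr => i _; rewrite (mulrCA (L i) p).
  under [in RHS]eq_bigr do rewrite (mulrCA (L i)).
  by rewrite -IH; apply: eq_bigr => i' _; rewrite (mulrCA (L i)).
transitivity (\sum_i (normsq (p * q) + 2 * a * dot (p * q) (w i * q)
    + a ^+ 2 * normsq (w i * q))).
  by apply: eq_bigr => i _; rewrite mulrDl -scalerAl normsqD normsqZ dotZr; ring.
have z : \sum_i dot (p * q) (w i * q) = 0.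
  by rewrite -dot_sumr -mulr_suml w0 mul0r dot0r.
by rewrite !big_split/= -!mulr_sumr z mulr0 addr0 sumr_const mulr_natl.
Qed.

Lemma sum_pascal (F : nat -> R) j :
  \sum_(t < j.+1) 'C(j, t)%:R * (F t + F t.+1) = \sum_(t < j.+2) 'C(j.+1, t)%:R * F t.
Proof.
rewrite [RHS]big_ord_recl/= bin0 mul1r.
under [in RHS]eq_bigr do rewrite /bump/= add1n binS natrD mulrDl.
rewrite big_split/= addrA; under eq_bigr do rewrite mulrDr; rewrite big_split/=.
congr (_ + _); transitivity (\sum_(t < j.+2) 'C(j, t)%:R * F t).
  by rewrite [RHS]big_ord_recr/= bin_small// mul0r addr0.
by rewrite big_ord_recl/= bin0 mul1r.
Qed.

(** A binomial theorem: by [itnorm_sum_shift], each of the [j] sums over [I] contributes either [p],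
    with weight |I|, or the [w i], with weight a^2, and no mixed term. *)
Lemma itnorm_shift (p : {mpoly R[k]}) (w : I -> {mpoly R[k]}) (a : R) j q :
  \sum_i w i = 0 ->
  itnorm (fun i => p + a *: w i) j q =
  \sum_(t < j.+1) 'C(j, t)%:R * (#|I|%:R ^+ (j - t) * (a ^+ 2) ^+ t)
     * itnorm w t (p ^+ (j - t) * q).
Proof.
move=> w0; elim: j q => [|j IH] q.
  by rewrite big_ord_recl big_ord0 /= !expr0 bin0 !mul1r addr0.
rewrite /=; under eq_bigr do rewrite IH.
rewrite exchange_big/=; under eq_bigr => t _.
  rewrite -mulr_sumr; under eq_bigr do rewrite (mulrCA (p ^+ _)).
  rewrite itnorm_sum_shift// (mulrA p) -exprS.
  over.
pose F t := #|I|%:R ^+ (j.+1 - t) * (a ^+ 2) ^+ t * itnorm w t (p ^+ (j.+1 - t) * q).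
rewrite [RHS](_ : _ = \sum_(t < j.+2) 'C(j.+1, t)%:R * F t); last first.
  by apply: eq_bigr => t _; rewrite /F -!mulrA.
rewrite -sum_pascal; apply: eq_bigr => t _.
have tj : (t <= j)%N by rewrite -ltnS.
by rewrite /F subSS (subSn tj) !exprS /=; ring.
Qed.

(** The induction moves a factor into [q], which lowers [j] and raises the degree [d] with j + d
    constant. At j = 0, [normsq_lin_mul] yields [S] plus the derivatives along the [v i], and by
    Euler's identity these cost at most [Lam] times the degree. *)
Lemma itnorm_succ_le (v : I -> 'I_k -> R) (S Lam : R) d j q :
  (forall y, \sum_i ip (v i) y ^+ 2 <= Lam * ip y y) ->
  \sum_i ip (v i) (v i) = S ->
  q \is d.-homog ->
  itnorm (fun i => lin (v i)) j.+1 q <=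
  (S + (j + d)%:R * Lam) * itnorm (fun i => lin (v i)) j q.
Proof.
move=> hL hS; elim: j d q => [|j IH] d q hq.
  rewrite /=; under eq_bigr do rewrite normsq_lin_mul.
  rewrite big_split/= -mulr_suml hS mulrDl lerD2l mulrAC -sum_normsq_mderiv//.
  by rewrite mulrC; exact: sum_normsq_lincomb_le.
rewrite [itnorm _ j.+1 q]/= mulr_sumr; apply: ler_sum => i _.
rewrite addSnnS; apply: IH; rewrite -add1n; apply: dhomogM => //.
rewrite /lin; apply: rpred_sum => r _; apply: rpredZ.
by rewrite dhomogX /= mdeg1.
Qed.

End iterated.

(** * An AM-GM inequality: from a product of distinct factors to arbitrary ones *)

Section amgm.
Variables (R : realFieldType) (k m : nat) (v : 'I_m -> 'I_k -> R).
Let L i := lin (v i).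
Let W := itnorm L.

(* [l] distinct factors and [j] arbitrary ones: up to normalization, making a
   factor arbitrary increases [Psi]. *)
Let Psi (l j : nat) : R := \sum_(s : 'S_m) W j (\prod_(a < m | (a < l)%N) L (s a)).

(** Write the arbitrary index as [s b]. If b >= l, the factor is a new one, and exchanging [b] with
    [c] gives equality. If b < l, it repeats a factor already present; [itnorm_lin2_le] compares the
    product of two different factors with the two squares, whose sums over [s] agree by the same
    exchange. *)
Let Psi_le l j : (l < m)%N -> m%:R * Psi l.+1 j <= Psi l j.+1.
Proof.
move=> lm; pose c := Ordinal lm.
have -> : Psi l j.+1 = \sum_(b < m) \sum_(s : 'S_m)
    W j (L (s b) * \prod_(a < m | (a < l)%N) L (s a)).
  rewrite exchange_big; apply: eq_bigr => s _ /=.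
  by rewrite /W/= (reindex_inj (@perm_inj _ s)).
rewrite mulr_natl -[in X in X <= _](card_ord m) -sumr_const; apply: ler_sum => b _.
have PsiE : Psi l.+1 j =
    \sum_(s : 'S_m) W j (L (s c) * \prod_(a < m | (a < l)%N) L (s a)).
  apply: eq_bigr => s _; rewrite (bigD1 c)/= ?ltnSn//; congr (W j (_ * _)).
  by apply: eq_bigl => a; rewrite ltnS -val_eqE/= [RHS]ltn_neqAle andbC.
have [bl|lb] := ltnP b l; last first.
  rewrite PsiE le_eqVlt; apply/orP; left; apply/eqP.
  rewrite (reindex_inj (mulgI (tperm b c))); apply: eq_bigr => s _.
  rewrite permM tpermR; congr (W j (_ * _)); apply: eq_bigr => a al.
  by rewrite permM tpermD// -val_eqE/= neq_ltn ?al ?orbT// (leq_trans al lb) orbT.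
pose q (s : 'S_m) := \prod_(a < m | (a < l)%N && (a != b)) L (s a).
have e (s : 'S_m) : \prod_(a < m | (a < l)%N) L (s a) = L (s b) * q s.
  by rewrite (bigD1 b).
rewrite -(ler_pM2l (ltr0n R 2)) PsiE.
under eq_bigr do rewrite e; under [X in _ <= _ * X]eq_bigr do rewrite e.
have -> : 2 * \sum_(s : 'S_m) W j (L (s b) * (L (s b) * q s)) =
    \sum_(s : 'S_m) W j (L (s c) * (L (s c) * q s)) +
    \sum_(s : 'S_m) W j (L (s b) * (L (s b) * q s)).
  rewrite mulr_natl mulr2n; congr (_ + _).
  rewrite (reindex_inj (mulgI (tperm b c))); apply: eq_bigr => s _.
  rewrite permM tpermL; congr (W j (_ * (_ * _))); apply: eq_bigr => a /andP[al ab].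
  by rewrite permM tpermD// 1?eq_sym// -val_eqE/= neq_ltn al.
rewrite mulr_sumr -big_split; apply: ler_sum => s _; exact: itnorm_lin2_le.
Qed.

(** [Psi_le] is iterated from [m] distinct factors down to none. Both ends of the chain carry the
    same m!, because neither summand depends on the permutation any more. *)
Lemma fock_amgm : m%:R ^+ m * normsq (\prod_i L i) <= W m 1.
Proof.
have h j : (j <= m)%N -> m%:R ^+ j * Psi m 0 <= Psi (m - j) j.
  elim: j => [|j IH] jm; first by rewrite expr0 mul1r subn0.
  rewrite exprS -mulrA; have := IH (ltnW jm); rewrite -(ler_pM2l (x := m%:R)).
    move/le_trans; apply; rewrite (_ : m - j = (m - j.+1).+1)%N.
      by apply: Psi_le; rewrite -subSn// subSS leq_subr.
    by rewrite -subSn.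
  by rewrite ltr0n (leq_trans _ jm).
have fact_gt0' : 0 < (m`!)%:R :> R by rewrite ltr0n fact_gt0.
have e1 : Psi m 0 = (m`!)%:R * normsq (\prod_i L i).
  rewrite mulr_natl -card_Sn -sumr_const; apply: eq_bigr => s _.
  rewrite /W/= [in RHS](reindex_inj (@perm_inj _ s)); congr normsq.
  by apply: eq_bigl => a; rewrite ltn_ord.
have e2 : Psi 0 m = (m`!)%:R * W m 1.
  rewrite mulr_natl -card_Sn -sumr_const; apply: eq_bigr => s _.
  by rewrite big_pred0.
have := h m (leqnn _); rewrite subnn e1 e2 mulrCA.
by rewrite ler_pM2l.
Qed.

End amgm.

(** * Permanents and Wick's formula *)

Section perm.
Variable R : comNzRingType.

Definition permanent n (M : 'I_n -> 'I_n -> R) : R := \sum_(s : 'S_n) \prod_i M i (s i).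

(** Laplace expansion along the first row: a permutation is the image [j] of the first index
    together with a permutation of the rest, glued by [lift_perm]. *)
Lemma expand_permanent n (M : 'I_n.+1 -> 'I_n.+1 -> R) :
  permanent M =
  \sum_j M ord0 j * permanent (fun i i' => M (lift ord0 i) (lift j i')).
Proof.
pose f (x : 'I_n.+1 * 'S_n) := lift_perm ord0 x.1 x.2.
have f_inj : injective f.
  move=> [j s] [j' s'] /permP e.
  have jj' : j = j' by have := e ord0; rewrite !lift_perm_id.
  subst j'; congr pair; apply/permP => i.
  by have := e (lift ord0 i); rewrite !lift_perm_lift => /lift_inj.
have f_bij : bijective f.
  by apply: inj_card_bij => //; rewrite card_prod card_ord !card_Sn factS.
rewrite /permanent (reindex f) /=; last exact: onW_bij.
under [RHS]eq_bigr do rewrite mulr_sumr.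
rewrite pair_bigA/=; apply: eq_bigr => -[j s] _.
rewrite big_ord_recl lift_perm_id; congr (_ * _).
by apply: eq_bigr => i _; rewrite lift_perm_lift.
Qed.

End perm.

Section wick.
Variables (R : realFieldType) (k : nat).

Lemma der_prod (I : eqType) (v : 'I_k -> R) (r : seq I) (F : I -> {mpoly R[k]}) :
  uniq r -> der v (\prod_(i <- r) F i) =
  \sum_(j <- r) der v (F j) * \prod_(i <- r | i != j) F i.
Proof.
elim: r => [_|x r IH /= /andP[xr ur]].
  rewrite !big_nil -(mpolyC1) /der big1// => i _.
  by rewrite mderivC scaler0.
rewrite big_cons derM IH// [RHS]big_cons big_cons eqxx/=; congr (_ + _).
  congr (_ * _); rewrite big_seq [RHS]big_seq_cond; apply: eq_bigl => i.
  by case: eqVneq => [->|_]; rewrite ?andbT// andbF (negbTE xr).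
rewrite mulr_sumr; apply: eq_big_seq => j jr.
rewrite big_cons ifT; first by rewrite mulrCA.
by apply: contraNneq xr => ->.
Qed.

(** Moving the first factor across as a derivative and applying Leibniz's rule to the other product
    reproduces the expansion of the permanent along its first row. *)
Lemma wick n (v u : 'I_n -> 'I_k -> R) :
  dot (\prod_i lin (v i)) (\prod_i lin (u i)) = permanent (fun i j => ip (v i) (u j)).
Proof.
elim: n v u => [|n IH] v u.
  rewrite !big_ord0 -[dot 1 1]/(normsq 1) normsq1 /permanent (eq_bigr (fun=> 1)); last first.
    by move=> s _; rewrite big_ord0.
  by rewrite sumr_const card_Sn.
rewrite expand_permanent big_ord_recl dot_mul_lin der_prod ?index_enum_uniq//.
rewrite dot_sumr; apply: eq_bigr => j _.
rewrite der_lin mulr_algl dotZr -IH; congr (_ * dot _ _).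
rewrite big_mkcond (bigD1_ord j)//= eqxx mul1r.
by apply: eq_bigr => i _; rewrite eq_sym neq_lift.
Qed.

End wick.

(** * Gram vectors of a positive semidefinite matrix *)

Section cholesky.
Variable R : rcfType.

(** One index is removed at a time: its vector is [c] times a unit vector, with c^2 the corner
    entry, and the remaining vectors come from the Schur complement. *)
Lemma cholesky n (B : 'I_n -> 'I_n -> R) :
  (forall i j, B i j = B j i) ->
  (forall u : 'I_n -> R, 0 <= \sum_i \sum_j u i * u j * B i j) ->
  exists V : 'I_n -> 'I_n -> R, forall i j, B i j = ip (V i) (V j).
Proof.
elim: n B => [|n IH] B symB psdB.
  by exists (fun _ _ => 0) => -[].
pose u_ (x : R) (y : 'I_n -> R) (i : 'I_n.+1) := if unlift ord0 i is Some j then y j else x.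
have u0 x y : u_ x y ord0 = x by rewrite /u_ unlift_none.
have uS x y i : u_ x y (lift ord0 i) = y i by rewrite /u_ liftK.
pose b := B ord0 ord0; pose r i := B ord0 (lift ord0 i).
have quad x y : 0 <= b * x ^+ 2 + 2 * x * (\sum_i y i * r i) +
    \sum_i \sum_j y i * y j * B (lift ord0 i) (lift ord0 j).
  have := psdB (u_ x y); rewrite big_ord_recl big_ord_recl u0.
  under eq_bigr do rewrite uS.
  under [X in _ + X]eq_bigr do rewrite big_ord_recl u0 uS symB.
  under [X in _ + X]eq_bigr do under eq_bigr do rewrite uS.
  rewrite big_split/= => /le_trans; apply; rewrite le_eqVlt; apply/orP; left; apply/eqP.
  have -> : \sum_(i < n) x * y i * B ord0 (lift ord0 i) = x * \sum_i y i * r i.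
    by rewrite mulr_sumr; apply: eq_bigr => i _; rewrite mulrA.
  have -> : \sum_(i < n) y i * x * B ord0 (lift ord0 i) = x * \sum_i y i * r i.
    by rewrite mulr_sumr; apply: eq_bigr => i _; rewrite mulrA (mulrC x).
  by rewrite /b; ring.
have b_ge0 : 0 <= b.
  have := quad 1 (fun=> 0).
  rewrite big1 => [|i _]; last by rewrite mul0r.
  rewrite big1 => [|i _]; last by rewrite big1// => j _; rewrite !mul0r.
  by rewrite mulr0 !addr0 expr1n mulr1.
have r_eq0 : b = 0 -> forall i, r i = 0.
  move=> b0 i; apply/eqP/negPn/negP => ri0.
  pose y j : R := (j == i)%:R.
  (* With [b] zero the form is affine in its first coordinate; this value makes it equal to -1. *)
  have := quad (- (1 + B (lift ord0 i) (lift ord0 i)) / r i / 2) y.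
  have sum_y (F : 'I_n -> R) : \sum_j y j * F j = F i.
    rewrite (bigD1 i)//= /y eqxx mul1r big1 ?addr0// => j /negbTE ->.
    by rewrite mul0r.
  rewrite sum_y.
  under eq_bigr do under eq_bigr do rewrite -mulrA.
  under eq_bigr do rewrite -mulr_sumr sum_y.
  rewrite sum_y b0 mul0r add0r.
  have -> : 2 * (- (1 + B (lift ord0 i) (lift ord0 i)) / r i / 2) * r i =
    - (1 + B (lift ord0 i) (lift ord0 i)) by field.
  by lra.
pose c := Num.sqrt b; pose l i := r i / c.
have c2 : c ^+ 2 = b by exact: sqr_sqrtr.
(* If [c] is 0, then [l i] is 0 by the convention on division, which is consistent since [r i]
   vanishes too. *)
have rl i : r i = c * l i.
  have [c0|c0] := eqVneq c 0.
    by rewrite /l c0 mul0r r_eq0// -c2 c0 expr0n.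
  by rewrite /l; field.
have [||V hV] := IH (fun i j => B (lift ord0 i) (lift ord0 j) - l i * l j).
- by move=> i j; rewrite symB (mulrC (l i)).
- move=> y; set s := \sum_i y i * l i.
  (* For [c] nonzero this is the minimizer in the first coordinate, and what is left is the Schur
     complement; for [c] zero, [s] is zero as well. *)
  have := quad (- s / c) y.
  have -> : \sum_i y i * r i = c * s.
    by rewrite mulr_sumr; apply: eq_bigr => i _; rewrite rl mulrCA.
  have -> : b * (- s / c) ^+ 2 + 2 * (- s / c) * (c * s) = - (s * s).
    rewrite -c2; have [c0|c0] := eqVneq c 0; last by field.
    rewrite /s /l c0 invr0 big1 => [|i _]; last by rewrite !mulr0.
    by ring.
  move=> /le_trans; apply; rewrite le_eqVlt; apply/orP; left; apply/eqP.
  rewrite {1}/s mulr_suml -sumrN -big_split; apply: eq_bigr => i _ /=.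
  rewrite /s mulr_sumr -sumrN -big_split; apply: eq_bigr => j _ /=.
  by ring.
exists (fun i => if unlift ord0 i is Some i' then u_ (l i') (V i') else u_ c (fun=> 0)).
have ip_u x y x' y' : ip (u_ x y) (u_ x' y') = x * x' + ip y y'.
  by rewrite /ip big_ord_recl !u0; under eq_bigr do rewrite !uS.
have ip0 y : ip (fun=> 0) y = 0 :> R by rewrite /ip big1// => i _; rewrite mul0r.
move=> i j; case: (unliftP ord0 i) => [i'|] ->; case: (unliftP ord0 j) => [j'|] ->;
  rewrite ip_u ?(ip0, ipC _ (fun=> 0)) ?addr0.
- by rewrite -hV addrC subrK.
- by rewrite symB -/(r i') rl mulrC.
- by rewrite -/(r j') rl.
- by rewrite -/b -c2 expr2.
Qed.

End cholesky.

(** * Splitting off the variable of the constant function *)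

Section vacuum.
Variables (R : realFieldType) (k : nat).
Implicit Types (p q : {mpoly R[k.+1]}).
Let X0 : {mpoly R[k.+1]} := 'X_ord0.
Let d0 (q : {mpoly R[k.+1]}) := mderiv ord0 q.

Lemma mderiv_X0pow b q : d0 q = 0 -> d0 (X0 ^+ b * q) = b%:R *: (X0 ^+ b.-1 * q).
Proof.
move=> q0; elim: b => [|b IH]; first by rewrite expr0 mul1r scale0r.
rewrite exprS -mulrA /d0 mderivM mderiv_var eqxx mul1r -/(d0 _) IH -scalerAr.
case: b {IH} => [|b]; first by rewrite scale0r addr0 scale1r.
by rewrite /= (mulrA X0) -exprS -[in RHS]natr1 scalerDl scale1r addrC.
Qed.

(** The condition [d0 q = 0] says that [q] is free of X_0. Powers of X_0 are moved across one by one
    as derivatives: unequal exponents end in 0, equal ones leave b!. *)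
Lemma dot_X0pow b c q q' : d0 q = 0 -> d0 q' = 0 ->
  dot (X0 ^+ b * q) (X0 ^+ c * q') = (b == c)%:R * (b`!)%:R * dot q q'.
Proof.
move=> q0 q'0; elim: b c => [|b IH] [|c].
- by rewrite !expr0 !mul1r.
- by rewrite dotC exprS -mulrA dot_mulX mul1r -/(d0 _) q0 dot0r !mul0r.
- by rewrite exprS -mulrA dot_mulX mul1r -/(d0 _) q'0 dot0r !mul0r.
rewrite exprS -mulrA dot_mulX -/(d0 _) mderiv_X0pow// dotZr IH eqSS.
by have [->|] := eqVneq b c; rewrite ?mul0r ?mulr0// factS natrM; ring.
Qed.

Lemma itnorm_X0pow (I : finType) (w : I -> {mpoly R[k.+1]}) t b q :
  (forall i, d0 (w i) = 0) -> d0 q = 0 ->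
  itnorm w t (X0 ^+ b * q) = (b`!)%:R * itnorm w t q.
Proof.
move=> w0; elim: t q => [|t IH] q q0 /=.
  by rewrite /normsq dot_X0pow// eqxx mul1r.
rewrite mulr_sumr; apply: eq_bigr => i _; rewrite mulrCA IH//.
by rewrite /d0 mderivM -!/(d0 _) w0 q0 mul0r mulr0 addr0.
Qed.

Lemma d0_lin (v : 'I_k.+1 -> R) : v ord0 = 0 -> d0 (lin v) = 0.
Proof.
move=> v0; rewrite /d0 /lin raddf_sum/= big1// => r _; rewrite mderivZ mderiv_var.
by case: eqVneq => [<-|_]; rewrite ?scaler0// v0 scale0r.
Qed.

Lemma d0_der v q : d0 q = 0 -> d0 (der v q) = 0.
Proof.
move=> q0; rewrite /d0 /der raddf_sum/= big1// => r _.
by rewrite mderivZ mderiv_comm -/(d0 q) q0 raddf0 scaler0.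
Qed.

Lemma der_X0pow v b q : v ord0 = 0 -> der v (X0 ^+ b * q) = X0 ^+ b * der v q.
Proof.
move=> v0; elim: b => [|b IH]; first by rewrite !expr0 !mul1r.
rewrite exprS -!mulrA derM IH /der big1 ?mul0r ?add0r// => r _.
by rewrite mderiv_var; case: eqVneq => [->|_]; rewrite ?scaler0// v0 scale0r.
Qed.

(** [e t] is the elementary symmetric polynomial of degree [t] in the linear forms. It does not
    depend on [a], so one family serves both the original product and the shifted one. Its vanishing
    beyond [size r] settles the top degree when the list grows. *)
Lemma prod_X0_expand (I : Type) (r : seq I) (v : I -> 'I_k.+1 -> R) :
  (forall i, v i ord0 = 0) ->
  exists e : nat -> {mpoly R[k.+1]},
  [/\ forall t, e t \is t.-homog, forall t, d0 (e t) = 0,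
      forall t, (size r < t)%N -> e t = 0 &
      forall a, \prod_(i <- r) (X0 + a *: lin (v i)) =
        \sum_(t < (size r).+1) a ^+ t *: (X0 ^+ (size r - t) * e t)].
Proof.
move=> v0; elim: r => [|i r [e [e_homog e_d0 e_small eE]]].
  exists (fun t => (t == 0%N)%:R); split => [t|t|t|a].
  - by case: eqVneq => [->|_]; [exact: dhomog1|exact: rpred0].
  - by case: eqVneq => _; rewrite /d0 ?raddf0// -(mpolyC1) mderivC.
  - by case: eqVneq => // ->.
  - by rewrite big_nil big_ord_recl big_ord0 /= !expr0 scale1r mul1r addr0.
have lin_homog j : lin (v j) \is 1.-homog.
  rewrite /lin; apply: rpred_sum => s _; apply: rpredZ.
  by rewrite dhomogX /= mdeg1.
exists (fun t => e t + if t is t'.+1 then lin (v i) * e t' else 0); split.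
- case=> [|t]; first by rewrite addr0.
  by rewrite rpredD// -(add1n t) dhomogM.
- case=> [|t]; first by rewrite addr0.
  rewrite /d0 mderivD mderivM -!/(d0 _) !e_d0 d0_lin//.
  by rewrite mul0r mulr0 !addr0.
- by case=> [|t]//= rt; rewrite !e_small ?mulr0 ?addr0// ltnW.
move=> a; rewrite big_cons eE mulrDl [size _]/=.
under [RHS]eq_bigr do rewrite mulrDr scalerDr.
rewrite big_split/=; congr (_ + _).
  rewrite [RHS]big_ord_recr/= e_small// mulr0 scaler0 addr0 mulr_sumr.
  apply: eq_bigr => t _; rewrite -scalerAr mulrA -exprS subSn//.
  by rewrite -ltnS.
rewrite [RHS]big_ord_recl mulr0 scaler0 add0r mulr_sumr; apply: eq_bigr => t _ /=.
by rewrite /bump/= add1n subSS -scalerAl -scalerAr scalerA -exprS mulrCA.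
Qed.

Lemma normsq_X0_sum n (c : nat -> R) (e : nat -> {mpoly R[k.+1]}) :
  (forall t, d0 (e t) = 0) ->
  normsq (\sum_(t < n.+1) c t *: (X0 ^+ (n - t) * e t)) =
  \sum_(t < n.+1) c t ^+ 2 * ((n - t)`!)%:R * normsq (e t).
Proof.
move=> e0; rewrite /normsq dot_suml; apply: eq_bigr => t _.
rewrite dot_sumr (bigD1 t)//= dotZl dotZr dot_X0pow// eqxx big1 ?addr0; last first.
  move=> s st; rewrite dotZl dotZr dot_X0pow// (_ : (n - t == n - s)%N = false) ?mul0r ?mulr0//.
  apply/negbTE; apply: contra st => /eqP h; apply/eqP/val_inj => /=.
  have := ltn_ord t; have := ltn_ord s; rewrite !ltnS => sn tn.
  by rewrite -(subKn sn) -h subKn.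
by rewrite mul1r; ring.
Qed.

End vacuum.

Lemma eq_itnorm (R : realFieldType) (k : nat) (I : finType) (L1 L2 : I -> {mpoly R[k]}) j q :
  L1 =1 L2 -> itnorm L1 j q = itnorm L2 j q.
Proof.
by move=> e; elim: j q => //= j IH q; apply: eq_bigr => i _; rewrite e IH.
Qed.

(** * Norm bounds for the shifted product and for multiplication by [lin g] *)

Section bound.
Variables (R : realFieldType) (k m : nat) (g : 'I_k.+1 -> R) (v : 'I_m -> 'I_k.+1 -> R).
Hypotheses (m_gt0 : (0 < m)%N) (g0 : g ord0 = 0) (v0 : forall i, v i ord0 = 0).
Hypothesis v_sum0 : \sum_i lin (v i) = 0.
Variables (C lam a delta : R).
Hypothesis vC : \sum_i ip (v i) (v i) = m%:R * C.
Hypothesis C_ge0 : 0 <= C.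
Hypothesis lam_ge0 : 0 <= lam.
Hypothesis v_lam : forall y, \sum_i ip (v i) y ^+ 2 <= m%:R * lam * ip y y.
Hypothesis delta_ge : forall t, t.+1%:R <= delta * (a ^+ 2) ^+ t.
Let X0 : {mpoly R[k.+1]} := 'X_ord0.

(** Starting from the constant 1, of degree 0, each new factor multiplies the bound by m (C + t lam)
    according to [itnorm_succ_le]. *)
Let itnorm_le t : itnorm (fun i => lin (v i)) t 1 <=
  m%:R ^+ t * \prod_(u < t) (C + u%:R * lam).
Proof.
elim: t => [|t IH]; first by rewrite big_ord0 mulr1 expr0 /= normsq1.
have h0 : 0 <= C + t%:R * lam by rewrite addr_ge0// mulr_ge0.
have := itnorm_succ_le (d := 0) t v_lam vC (dhomog1 _ _).
rewrite addn0 => /le_trans; apply.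
rewrite big_ord_recr/= exprSr mulrACA [leRHS]mulrC.
rewrite (_ : m%:R * C + _ = m%:R * (C + t%:R * lam)); last by ring.
by apply: ler_wpM2l => //; rewrite mulr_ge0.
Qed.

(** [fock_amgm] passes to arbitrary index maps, where [itnorm_shift] removes the cross terms. The
    power of X_0 contributes (m - t)!, and binomial(m, t) (m - t)! = m! / t! supplies the
    denominators. *)
Lemma shifted_prod_le : normsq (\prod_i (X0 + a *: lin (v i))) <=
  (m`!)%:R * \sum_(t < m.+1) (a ^+ 2) ^+ t * \prod_(u < t) ((C + u%:R * lam) / u.+1%:R).
Proof.
have mR : 0 < m%:R ^+ m :> R by rewrite exprn_gt0// ltr0n.
pose va i r := (r == ord0)%:R + a * v i r.
have linE i : X0 + a *: lin (v i) = lin (va i).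
  rewrite /lin /va; under [RHS]eq_bigr do rewrite scalerDl -scalerA.
  rewrite big_split/= -scaler_sumr; congr (_ + _).
  by rewrite (bigD1 ord0)//= scale1r big1 ?addr0// => r /negbTE ->; rewrite scale0r.
rewrite -(ler_pM2l mR); under eq_bigr do rewrite linE.
apply: (le_trans (fock_amgm va)).
have -> : itnorm (fun i => lin (va i)) m 1 = itnorm (fun i => X0 + a *: lin (v i)) m 1.
  by apply: eq_itnorm => i; rewrite linE.
rewrite itnorm_shift// card_ord [leRHS]mulrA mulr_sumr.
apply: ler_sum => t _; have tm : (t <= m)%N by rewrite -ltnS.
rewrite itnorm_X0pow//; last 2 first.
- by move=> i; exact: d0_lin.
- by rewrite /= -mpolyC1 mderivC.
have -> : (m`!)%:R = 'C(m, t)%:R * (t`!)%:R * ((m - t)`!)%:R :> R.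
  by rewrite -!natrM -(bin_fact tm) mulnA.
rewrite prodf_div -natr_prod [X in _ / X%:R](_ : _ = t`!)%N; last first.
  by rewrite fact_prod big_add1 big_mkord.
have -> : m%:R ^+ m = m%:R ^+ (m - t) * m%:R ^+ t :> R by rewrite -exprD subnK.
set x := itnorm _ _ _; set y := \prod_(u < t) _.
have t0 : (t`!)%:R != 0 :> R by rewrite pnatr_eq0 -lt0n fact_gt0.
set K := 'C(m, t)%:R * m%:R ^+ (m - t) * (a ^+ 2) ^+ t * ((m - t)`!)%:R.
have -> : 'C(m, t)%:R * (m%:R ^+ (m - t) * a ^+ 2 ^+ t) * (((m - t)`!)%:R * x) = K * x.
  by rewrite /K; ring.
rewrite [leRHS](_ : _ = K * (m%:R ^+ t * y)); last by rewrite /K; field.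
rewrite ler_wpM2l ?itnorm_le// /K !mulr_ge0//; first exact/exprn_ge0.
by apply/exprn_ge0; exact: sqr_ge0.
Qed.

(** Compare the components of each degree t in the [v i]. By [normsq_lin_mul] and [normsq_der_le],
    multiplication by [lin g] costs |g|^2 (1 + t), and [delta_ge] absorbs 1 + t into delta
    a^(2t). *)
Lemma creation_prod_le : normsq (lin g * \prod_i (X0 + lin (v i))) <=
  ip g g * delta * normsq (\prod_i (X0 + a *: lin (v i))).
Proof.
have [e [e_homog e_d0 _ eE]] := prod_X0_expand (index_enum 'I_m) v0.
have sz : size (index_enum 'I_m) = m by rewrite [index_enum _]unlock -enumT size_enum_ord.
rewrite sz in eE.
have gg : 0 <= ip g g by apply: sumr_ge0 => r _; rewrite -expr2 sqr_ge0.
have -> : \prod_i (X0 + lin (v i)) = \sum_(t < m.+1) 1 ^+ t *: (X0 ^+ (m - t) * e t).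
  by rewrite -eE; apply: eq_bigr => i _; rewrite scale1r.
rewrite eE normsq_lin_mul der_sum.
rewrite [X in _ + normsq X](_ : _ =
    \sum_(t < m.+1) 1 ^+ t *: (X0 ^+ (m - t) * der g (e t))); last first.
  by apply: eq_bigr => t _; rewrite derZ der_X0pow.
have E c (e' : nat -> {mpoly R[k.+1]}) : (forall t, mderiv ord0 (e' t) = 0) ->
    normsq (\sum_(t < m.+1) c ^+ t *: (X0 ^+ (m - t) * e' t)) =
    \sum_(t < m.+1) (c ^+ t) ^+ 2 * ((m - t)`!)%:R * normsq (e' t).
  exact: (normsq_X0_sum m (fun t => c ^+ t)).
rewrite (E 1 e)// (E a e)// (E 1 (fun t => der g (e t))); last first.
  by move=> t; exact: d0_der.
rewrite !mulr_sumr -big_split; apply: ler_sum => t _ /=.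
rewrite !expr1n !mul1r.
have h1 := normsq_der_le g (e_homog t).
have h2 : 0 <= normsq (e t) by exact: normsq_ge0.
apply: (@le_trans _ _ (((m - t)`!)%:R * (ip g g * (t.+1%:R * normsq (e t))))).
  rewrite mulrCA -mulrDr ler_wpM2l// -natr1 mulrDl mul1r mulrDr addrC lerD2r.
  exact: h1.
rewrite [leRHS](_ : _ = ((m - t)`!)%:R * (ip g g * ((delta * (a ^+ 2) ^+ t) * normsq (e t)))).
  by rewrite ler_wpM2l// ler_wpM2l// ler_wpM2r.
by rewrite -!exprM (mulnC 2); ring.
Qed.

End bound.

(** * The permanent of a Gram matrix as a squared norm of polynomials *)

Section gram.
Variables (R : rcfType) (m : nat) (A : 'I_m.+1 -> 'I_m.+1 -> R) (C lam : R).
Hypothesis m_gt0 : (0 < m)%N.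
(** The Gram matrix after centring: index 0 stands for a vector of mean 0, the other indices for
    vectors of mean 1. *)
Let B i j := A i j - ((i != ord0) && (j != ord0))%:R.
Hypothesis symA : forall i j, A i j = A j i.
Hypothesis psdB : forall u : 'I_m.+1 -> R, 0 <= \sum_i \sum_j u i * u j * B i j.
Hypothesis B_sum0 : forall i, \sum_j B i (lift ord0 j) = 0.
Hypothesis trB : \sum_i B (lift ord0 i) (lift ord0 i) = m%:R * C.
Hypothesis lam_ge0 : 0 <= lam.
Hypothesis B_lam : forall u : 'I_m -> R,
  \sum_i \sum_j u i * u j * B (lift ord0 i) (lift ord0 j) <=
  m%:R * lam * \sum_i u i ^+ 2.

(** Vectors realizing [B] are placed in coordinates other than X_0. Adding X_0 to every linear form
    except the first restores [A], so Wick's formula makes the permanent a squared norm. The facts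
    on [C] are returned as well, because the later choice of [s] and [delta] rests on them. *)
Lemma gram_permanent_le (s delta : R) : 0 <= s ->
  (forall t, t.+1%:R <= delta * s ^+ t) ->
  permanent A <= A ord0 ord0 * delta * ((m`!)%:R *
    \sum_(t < m.+1) s ^+ t *
       \prod_(u < t) ((C + u%:R * Num.min C lam) / u.+1%:R)) /\
  0 <= C /\ (lam = 0 -> C = 0).
Proof.
move=> s0 hdelta.
have symB i j : B i j = B j i by rewrite /B symA andbC.
have [V hV] := cholesky symB psdB.
pose emb (x : 'I_m.+1 -> R) (r : 'I_m.+2) := if unlift ord0 r is Some r' then x r' else 0.
have emb0 x : emb x ord0 = 0 by rewrite /emb unlift_none.
have embS x r : emb x (lift ord0 r) = x r by rewrite /emb liftK.
have ip_emb x y : ip (emb x) (emb y) = ip x y.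
  by rewrite /ip big_ord_recl !emb0 mul0r add0r; apply: eq_bigr => r _; rewrite !embS.
pose g := emb (V ord0); pose v i := emb (V (lift ord0 i)).
have vB i j : ip (v i) (v j) = B (lift ord0 i) (lift ord0 j) by rewrite ip_emb hV.
have m0 : 0 < m%:R :> R by rewrite ltr0n.
have ipge0 n (x : 'I_n -> R) : 0 <= ip x x.
  by apply: sumr_ge0 => r _; rewrite -expr2 sqr_ge0.
have vC : \sum_i ip (v i) (v i) = m%:R * C by under eq_bigr do rewrite vB.
have C0 : 0 <= C by rewrite -(pmulr_rge0 _ m0) -vC sumr_ge0.
have sqE y : \sum_i ip (v i) y ^+ 2 = ip (fun r => \sum_i ip (v i) y * v i r) y.
  rewrite [RHS]/ip; under [RHS]eq_bigr do rewrite mulr_suml.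
  rewrite exchange_big/=; apply: eq_bigr => i _; rewrite expr2 {2}/ip mulr_sumr.
  by apply: eq_bigr => r _; rewrite mulrA.
(* [B_lam] bounds the Gram matrix of the [v i]; the operator sum of v_i v_i^T obeys the same bound.
   With [z] the image of [y], Cauchy-Schwarz gives Q^2 <= |z|^2 |y|^2 <= m lam Q |y|^2, and one [Q]
   cancels. *)
have v_lam y : \sum_i ip (v i) y ^+ 2 <= m%:R * lam * ip y y.
  set Q := \sum_i _; have Q0 : 0 <= Q by apply: sumr_ge0 => i _; exact: sqr_ge0.
  have [->|Qn0] := eqVneq Q 0; first by rewrite !mulr_ge0// ltW.
  have Qgt0 : 0 < Q by rewrite lt_neqAle eq_sym Qn0.
  set z := fun r => \sum_i ip (v i) y * v i r.
  have QE : Q = ip z y by exact: sqE.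
  have zz : ip z z <= m%:R * lam * Q.
    apply: le_trans (B_lam (fun i => ip (v i) y)).
    rewrite le_eqVlt; apply/orP; left; apply/eqP; rewrite {1}/ip {1}/z.
    under eq_bigr do rewrite mulr_suml.
    rewrite exchange_big/=; apply: eq_bigr => i _.
    under [RHS]eq_bigr do rewrite -vB {3}/ip mulr_sumr.
    rewrite exchange_big/=; apply: eq_bigr => r _.
    by rewrite /z mulr_sumr; apply: eq_bigr => j _; ring.
  rewrite -(ler_pM2l Qgt0) -[leLHS]expr2 {1}QE.
  apply: (le_trans (cauchy_schwarz_sum z y)).
  by rewrite mulrCA mulrA [leRHS]mulrC [leRHS]mulrC ler_wpM2r// mulrC.
(* The trace bounds the operator, so [lam] may be lowered to its minimum with [C]. *)
have v_C y : \sum_i ip (v i) y ^+ 2 <= m%:R * C * ip y y.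
  rewrite -vC mulr_suml; apply: ler_sum => i _; exact: cauchy_schwarz_sum.
have v_min y : \sum_i ip (v i) y ^+ 2 <= m%:R * Num.min C lam * ip y y.
  by case: (leP C lam).
have lamC : lam = 0 -> C = 0.
  move=> l0; apply/eqP; rewrite -(inj_eq (mulfI (lt0r_neq0 m0))) mulr0 -vC.
  rewrite big1// => j _; apply/eqP; rewrite -sqrf_eq0; apply/eqP/le_anti.
  rewrite sqr_ge0 andbT; have := v_lam (v j); rewrite l0 mulr0 mul0r.
  by apply: le_trans; rewrite (bigD1 j)//= lerDl sumr_ge0// => i _; exact: sqr_ge0.
split; last by [].
have v_sum0 : \sum_i lin (v i) = 0.
  rewrite /lin exchange_big/= big1// => r _; rewrite -scaler_suml.
  suff -> : \sum_i v i r = 0 by rewrite scale0r.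
  pose z r' := \sum_i v i r'.
  have zz : ip z z = 0.
    rewrite /ip /z; under eq_bigr do rewrite mulr_suml.
    rewrite exchange_big/= big1// => i _.
    under eq_bigr do rewrite mulr_sumr.
    rewrite exchange_big/=; transitivity (\sum_j ip (v i) (v j)) => //.
    by under eq_bigr do rewrite vB; exact: B_sum0.
  apply/eqP; rewrite -sqrf_eq0; apply/eqP/le_anti; rewrite sqr_ge0 andbT.
  have : z r ^+ 2 <= ip z z.
    rewrite /ip (bigD1 r)//= -expr2 lerDl sumr_ge0// => r' _.
    by rewrite -expr2 sqr_ge0.
  by rewrite zz.
pose a := Num.sqrt s; have a2 : a ^+ 2 = s by exact: sqr_sqrtr.
have lmin : 0 <= Num.min C lam by rewrite le_min C0.
have hd t : t.+1%:R <= delta * (a ^+ 2) ^+ t by rewrite a2.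
have vz i : v i ord0 = 0 by exact: emb0.
have d0 : 0 <= delta by have := hd 0%N; rewrite expr0 mulr1 => /(le_trans _); apply.
have := @creation_prod_le R m.+1 m g v (emb0 _) vz a delta hd.
have := @shifted_prod_le R m.+1 m v m_gt0 vz v_sum0 C _ a vC C0 lmin v_min.
have gA : ip g g = A ord0 ord0 by rewrite ip_emb -hV /B subr0.
rewrite gA a2 => h1 h2.
have -> : permanent A = normsq (lin g * \prod_i ('X_ord0 + lin (v i))).
  pose vv (i : 'I_m.+1) (r : 'I_m.+2) : R := ((i != ord0) && (r == ord0))%:R + emb (V i) r.
  have linE i : 'X_ord0 + lin (v i) = lin (vv (lift ord0 i)).
    rewrite /lin /vv; under [RHS]eq_bigr do rewrite scalerDl.
    rewrite big_split/=; congr (_ + _).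
    by rewrite (bigD1 ord0)//= scale1r big1 ?addr0// => r /negbTE ->; rewrite scale0r.
  have lin0 : lin g = lin (vv ord0).
    by apply: eq_bigr => r _; rewrite /vv eqxx add0r.
  under eq_bigr do rewrite linE.
  have -> : lin g * \prod_i lin (vv (lift ord0 i)) = \prod_i lin (vv i).
    by rewrite [RHS]big_ord_recl lin0.
  rewrite /normsq wick; apply: eq_bigr => p _; apply: eq_bigr => i _.
  rewrite /ip big_ord_recl /vv !emb0 !addr0 eqxx !andbT.
  under eq_bigr do rewrite !embS/= !andbF !add0r.
  rewrite -/(ip _ _) -hV /B.
  by case: (_ != _); case: (_ != _); rewrite /= ?mulr0 ?mul0r ?mulr1 ?add0r ?subr0// addrC subrK.
apply: (le_trans h2); apply: ler_wpM2l => //; rewrite mulr_ge0// -gA; exact: ipge0.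
Qed.

End gram.

End Fock.

From mathcomp Require Import all_classical all_reals all_analysis.
From mathcomp Require Import measurable_realfun.

Import Order.TTheory GRing.Theory Num.Theory.
Import numFieldNormedType.Exports.

Local Open Scope classical_set_scope.
Local Open Scope ring_scope.

(** * The binomial series and the final exponent *)

Section binomial_series.
Variables (R : realType) (b : R).
Hypothesis b_ge0 : 0 <= b.

(** The coefficient of x^t in (1 - x)^(-b). *)
Let c (t : nat) : R := \prod_(u < t) ((b + u%:R) / u.+1%:R).

Let c_ge0 t : 0 <= c t.
Proof. by apply: prodr_ge0 => u _; rewrite divr_ge0// addr_ge0. Qed.

Let cS t : t.+1%:R * c t.+1 = (b + t%:R) * c t.
Proof. by rewrite /c big_ord_recr/= mulrCA (mulrCA t.+1%:R) divff ?pnatr_eq0// mulr1 mulrC. Qed.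

Let p n : {poly R} := \poly_(t < n.+1) c t.

(* The derivative of the quotient of the partial sum [p n] by [(1 - x) ^ (- b)]
   is nonpositive. *)
Let p_ode n x : 0 <= x -> (1 - x) * (p n)^`().[x] <= b * (p n).[x].
Proof.
move=> x0; rewrite -subr_ge0.
suff -> : b * (p n).[x] - (1 - x) * (p n)^`().[x] = (n%:R + b) * c n * x ^+ n.
  by rewrite !mulr_ge0// ?addr_ge0// exprn_ge0.
have dE : (p n)^`().[x] = \sum_(t < n) (b + t%:R) * c t * x ^+ t.
  rewrite (@horner_coef_wide _ n); last first.
    apply: (leq_trans (size_poly _ _)).
    by rewrite -subn1 leq_subLR add1n size_poly.
  apply: eq_bigr => t _; rewrite coef_deriv coef_poly ltnS ltn_ord -cS.
  by rewrite mulr_natl.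
have pE : (p n).[x] = \sum_(t < n.+1) c t * x ^+ t.
  rewrite (@horner_coef_wide _ n.+1) ?size_poly//.
  by apply: eq_bigr => t _; rewrite coef_poly ltn_ord.
rewrite dE pE; elim: n {dE pE} => [|n IH].
  by rewrite big_ord0 big_ord_recl big_ord0 expr0; ring.
rewrite big_ord_recr/= mulrDr [in X in _ - X]big_ord_recr/= mulrDr opprD addrACA IH.
rewrite exprS; have := cS n; rewrite -natr1 => e.
transitivity (b * (c n.+1 * (x * x ^+ n)) + x * ((b + n%:R) * c n) * x ^+ n).
  by ring.
by rewrite -e; ring.
Qed.

(** The quotient [f] of the partial sum by (1 - x)^(-b) equals 1 at 0 and, by [p_ode], does not
    increase on [0, x]. *)
Lemma binomial_series_le n x : 0 <= x < 1 ->
  \sum_(t < n.+1) c t * x ^+ t <= expR (- b * ln (1 - x)).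
Proof.
move=> /andP[x0 x1].
have -> : \sum_(t < n.+1) c t * x ^+ t = (p n).[x].
  rewrite (@horner_coef_wide _ n.+1) ?size_poly//.
  by apply: eq_bigr => t _; rewrite coef_poly ltn_ord.
pose f y := (p n).[y] * expR (b * ln (1 - y)).
have df (y : R) : y < 1 -> is_derive y 1 f
    ((p n).[y] * (expR (b * ln (1 - y)) * (b * ((1 - y)^-1 * -1))) +
     expR (b * ln (1 - y)) * (p n)^`().[y]).
  move=> y1; have y1' : 0 < 1 - y by rewrite subr_gt0.
  have dp : is_derive y 1 (horner (p n)) (p n)^`().[y].
    by apply: DeriveDef; [exact: derivable_horner|rewrite -derive1E derivE].
  have dB : is_derive y 1 (fun z : R => 1 - z) (-1).
    by rewrite -[- 1]add0r; exact: (is_deriveB (is_derive_cst _ _ _) (is_derive_id _ _)).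
  have dl : is_derive y 1 (fun z : R => ln (1 - z)) ((1 - y)^-1 * -1).
    have := is_derive1_ln y1'; move=> dln.
    exact: is_derive1_comp.
  have dbl : is_derive y 1 (fun z : R => b * ln (1 - z)) (b * ((1 - y)^-1 * -1)).
    exact: is_deriveZ.
  have de : is_derive y 1 (fun z : R => expR (b * ln (1 - z)))
     (expR (b * ln (1 - y)) * (b * ((1 - y)^-1 * -1))).
    exact: is_derive1_comp.
  exact: is_deriveM.
have fle : f x <= f 0.
  have sub y : y \in `]0, x[ -> y < 1.
    by rewrite in_itv/= => /andP[_ yx]; exact: lt_trans yx x1.
  apply: (@ler0_derive1_nincr _ f 0 x) => //.
  - by move=> y /sub y1; have [] := df y y1.
  - move=> y yx; have y1 := sub _ yx; have y1' : 0 < 1 - y by rewrite subr_gt0.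
    have [_ ] := df y y1; rewrite -derive1E => ->.
    have -> : (p n).[y] * (expR (b * ln (1 - y)) * (b * ((1 - y)^-1 * -1))) +
     expR (b * ln (1 - y)) * (p n)^`().[y] =
     expR (b * ln (1 - y)) / (1 - y) * ((1 - y) * (p n)^`().[y] - b * (p n).[y]).
      by field; rewrite gt_eqF.
    rewrite mulr_ge0_le0 ?subr_le0 ?p_ode// ?divr_ge0 ?expR_ge0// ?ltW//.
    by move: yx; rewrite in_itv/= => /andP[].
  - apply: derivable_within_continuous => y; rewrite in_itv/= => /andP[_ yx].
    by have [] := df y (le_lt_trans yx x1).
have f0 : f 0 = 1.
  rewrite /f subr0 ln1 mulr0 expR0 mulr1 horner_coef0 coef_poly /= /c.
  by rewrite big_ord0.
move: fle; rewrite f0 /f mulNr expRN -ler_pdivlMr ?expR_gt0//.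
by rewrite div1r.
Qed.

End binomial_series.

(** Put b = C / lam, x = (2 - lam) lam and L = - ln (1 - lam). Since 1 - x = (1 - lam)^2, the
    logarithm of the left side is at most L + 2 b L. This is at most 3 b L, as b >= 1, and L <= lam
    (1 + L) turns it into 3 C (1 + L). *)
Lemma gap_series_le (R : realType) (C lam : R) (n : nat) :
  0 <= lam -> lam <= C -> lam < 1 -> (lam = 0 -> C = 0) ->
  (1 - lam)^-1 * \sum_(t < n.+1) (2 - lam) ^+ t *
     \prod_(u < t) ((C + u%:R * lam) / u.+1%:R) <=
  expR (3 * C * (1 - ln (1 - lam))).
Proof.
move=> lam0 lamC lam1 C0.
have l1 : 0 < 1 - lam by rewrite subr_gt0.
(* At lam = 0 the quotient [b] would be meaningless, but [C] is 0 too and only the term t = 0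
   survives. *)
have [lamz|lamn0] := eqVneq lam 0.
  rewrite lamz C0// !subr0 invr1 mul1r mulr0 mul0r expR0 big_ord_recl big_ord0.
  rewrite expr0 mulr1 big1 ?addr0// => i _.
  by rewrite big_ord_recl /= mulr0 addr0 !mul0r mulr0.
have lamgt0 : 0 < lam by rewrite lt_neqAle eq_sym lamn0.
pose b := C / lam; have b1 : 1 <= b by rewrite ler_pdivlMr// mul1r.
have b0 : 0 <= b by rewrite (le_trans _ b1).
have Cb : C = b * lam by rewrite divfK.
pose x := (2 - lam) * lam.
have x1 : 1 - x = (1 - lam) ^+ 2 by rewrite /x; ring.
have x01 : 0 <= x < 1.
  rewrite -subr_gt0 x1 exprn_gt0// andbT mulr_ge0//; lra.
have -> : \sum_(t < n.+1) (2 - lam) ^+ t *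
     \prod_(u < t) ((C + u%:R * lam) / u.+1%:R) =
    \sum_(t < n.+1) (\prod_(u < t) ((b + u%:R) / u.+1%:R)) * x ^+ t.
  apply: eq_bigr => t _; rewrite Cb /x exprMn mulrCA; congr (_ * _).
  have -> : lam ^+ t = \prod_(u < t) lam by rewrite prodr_const card_ord.
  rewrite -big_split/=.
  by apply: eq_bigr => u _; rewrite -mulrDl; ring.
have inv_lamE : (1 - lam)^-1 = expR (- ln (1 - lam)) by rewrite expRN lnK.
apply: (@le_trans _ _ ((1 - lam)^-1 * expR (- b * ln (1 - x)))).
  by rewrite ler_wpM2l ?invr_ge0 ?(ltW l1)// binomial_series_le.
rewrite x1 lnXn// inv_lamE -expRD ler_expR.
set L := - ln (1 - lam).
have L0 : 0 <= L by rewrite /L oppr_ge0 ln_le0//; lra.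
(* From ln (1 + y) <= y at y = lam / (1 - lam), after multiplication by 1 - lam. *)
have Llam : L <= lam * (1 + L).
  have : L <= lam / (1 - lam).
    have e : (1 - lam)^-1 = 1 + lam / (1 - lam) by field; rewrite gt_eqF.
    rewrite /L -lnV ?posrE// {1}e.
    apply: le_ln1Dx; apply: (@lt_le_trans _ _ 0); first lra.
    by rewrite divr_ge0// ltW.
  by rewrite ler_pdivlMr//; lra.
have -> : - b * (ln (1 - lam) *+ 2) = 2 * b * L by rewrite /L; ring.
have h1 : L <= b * L by rewrite ler_peMl.
have h2 : b * L <= b * (lam * (1 + L)) by rewrite ler_wpM2l.
have h3 : C * (1 + L) = b * (lam * (1 + L)) by rewrite Cb mulrA.
have -> : 3 * C * (1 - ln (1 - lam)) = 3 * (C * (1 + L)) by rewrite mulrA.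
by rewrite h3; lra.
Qed.

Lemma bernoulli_le (R : realDomainType) (x : R) t : 0 <= x -> 1 + t%:R * x <= (1 + x) ^+ t.
Proof.
move=> x0; elim: t => [|t IH]; first by rewrite mul0r addr0 expr0.
rewrite exprS; apply: le_trans (ler_wpM2l _ IH); last by rewrite addr_ge0.
rewrite -natr1; have : 0 <= t%:R * x * x by rewrite !mulr_ge0.
by lra.
Qed.

Section gram_permanent_exp.
Variables (R : realType) (m : nat) (A : 'I_m.+1 -> 'I_m.+1 -> R) (C eps : R).
Hypothesis m_gt0 : (0 < m)%N.
Let B i j := A i j - ((i != ord0) && (j != ord0))%:R.
Hypothesis symA : forall i j, A i j = A j i.
Hypothesis psdB : forall u : 'I_m.+1 -> R, 0 <= \sum_i \sum_j u i * u j * B i j.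
Hypothesis B_sum0 : forall i, \sum_j B i (lift ord0 j) = 0.
Hypothesis trB : \sum_i B (lift ord0 i) (lift ord0 i) = m%:R * C.
Hypothesis eps_gt0 : 0 < eps.
Hypothesis eps_le1 : eps <= 1.
Hypothesis B_eps : forall u : 'I_m -> R,
  \sum_i \sum_j u i * u j * B (lift ord0 i) (lift ord0 j) <=
  m%:R * (1 - eps) * \sum_i u i ^+ 2.
Hypothesis A00_ge0 : 0 <= A ord0 ord0.

(** [gram_permanent_le] with s = 2 - l and delta = 1 / (1 - l), where l = min C (1 - eps), followed
    by [gap_series_le]. As eps <= 1 - l and C >= 0, replacing 1 - l by [eps] only enlarges the
    exponent. *)
Lemma gram_permanent_exp : Fock.permanent A <=
  A ord0 ord0 * (m`!)%:R * expR (3 * C * (1 - ln eps)).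
Proof.
have lam0 : 0 <= 1 - eps by rewrite subr_ge0.
have H := Fock.gram_permanent_le m_gt0 symA psdB B_sum0 trB lam0 B_eps.
(* A first call, at the admissible values s = 2 and delta = 1, extracts the facts on [C] that the
   choice of [l] needs. *)
have [] := H 2 1 (ler0n _ _).
  move=> t; have := bernoulli_le t (@ler01 R).
  by rewrite mulr1 mul1r addrC natr1 -[1 + 1]/(2%:R).
move=> _ [C0 lamC].
set l := Num.min C (1 - eps); have l0 : 0 <= l by rewrite le_min C0.
have leps : eps <= 1 - l by rewrite lerBrDl -lerBrDr ge_min lexx orbT.
have l1 : l < 1 by rewrite -subr_gt0 (lt_le_trans eps_gt0).
have l1' : 0 < 1 - l by rewrite subr_gt0.
have lC : l <= C by rewrite ge_min lexx.
have lz : l = 0 -> C = 0.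
  by rewrite /l; case: (leP C (1 - eps)).
have [||+ _] := H (2 - l) (1 - l)^-1.
- lra.
(* Bernoulli gives s^t >= 1 + t (1 - l); division by 1 - l leaves 1 / (1 - l) + t >= 1 + t. *)
- move=> t; have := bernoulli_le t (ltW l1').
  rewrite (_ : 1 + (1 - l) = 2 - l); last by ring.
  rewrite -(ler_pM2l (x := (1 - l)^-1)) ?invr_gt0// => /(le_trans _); apply.
  rewrite mulrDr mulr1 mulrCA mulVf ?gt_eqF// mulr1 -natr1 addrC lerD2r.
  by rewrite invf_ge1//; lra.
move=> /le_trans; apply; rewrite -!mulrA; apply: ler_wpM2l => //.
rewrite mulrCA; apply: ler_wpM2l => //.
apply: le_trans (gap_series_le m l0 lC l1 lz) _.
rewrite ler_expR -!mulrA; apply: ler_wpM2l => //; apply: ler_wpM2l => //.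
by rewrite lerD2l lerN2 ler_ln// posrE.
Qed.

End gram_permanent_exp.

(** * Densities *)

Local Open Scope ereal_scope.

(** Inversion is discontinuous at 0, so it is written as x times the power -1 of x^2; both sides are
    0 at x = 0. *)
Lemma measurable_invr (R : realType) : measurable_fun [set: R] (@GRing.inv R).
Proof.
rewrite (_ : @GRing.inv R = (fun x => x * (x ^+ 2) `^ (-1))%R); last first.
  apply/funext => x; rewrite powR_inv1 ?sqr_ge0// expr2 invfM mulrA.
  have [->|x0] := eqVneq x 0%R; first by rewrite invr0 mulr0.
  by rewrite divff// mul1r.
apply: measurable_funM => //.
apply: (measurableT_comp (measurable_powR _)).
exact: measurable_funX.
Qed.

Lemma measurable_sqrtr (R : realType) : measurable_fun [set: R] (@Num.sqrt R).
Proof. by apply: continuous_measurable_fun; exact: sqrt_continuous. Qed.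

Section has_density.
Context d (T : measurableType d) (R : realType).
Implicit Types (P Q L M : {finite_measure set T -> \bar R}) (f g : T -> R).

(** The relation dP = f dL, with [f] real and nonnegative at every point rather than almost
    everywhere, so that densities can be combined pointwise. *)
Definition has_density P L f := [/\ measurable_fun [set: T] f,
  forall x, (0 <= f x)%R &
  forall A, measurable A -> P A = \int[L]_(x in A) (f x)%:E].

Lemma has_density_dominates P L f : has_density P L f -> P `<< L.
Proof.
move=> [mf f0 Pf]; apply/null_content_dominatesP => A mA LA.
rewrite Pf//; apply: null_set_integral => //.
by apply: measurable_funTS; exact/measurable_EFinP.
Qed.

Lemma has_density_integrable P L f : has_density P L f ->
  L.-integrable [set: T] (EFin \o f).
Proof.
move=> [mf f0 Pf]; apply/integrableP; split; first exact/measurable_EFinP.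
under eq_integral do rewrite gee0_abs ?lee_fin//.
by rewrite -(Pf _ measurableT) ltey_eq fin_num_measure.
Qed.

Lemma has_density_unique P L f g : has_density P L f -> has_density P L g ->
  ae_eq L [set: T] (EFin \o f) (EFin \o g).
Proof.
move=> Pf Pg; have [mg _ hg] := Pg; have [_ _ hf] := Pf.
apply: integral_ae_eq => //.
- exact: has_density_integrable Pf.
- exact/measurable_EFinP.
- by move=> E _ mE; rewrite -hf// -hg.
Qed.

Lemma ge0_integral_density P L f (h : T -> \bar R) : has_density P L f ->
  measurable_fun [set: T] h -> (forall x, 0 <= h x) ->
  \int[P]_x h x = \int[L]_x (h x * (f x)%:E).
Proof.
move=> Pf mh h0; have PL := has_density_dominates Pf; have [mf f0 fE] := Pf.
rewrite -(Radon_Nikodym_SigmaFinite.change_of_variables PL)//.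
have mRN := measurable_int _ (Radon_Nikodym_SigmaFinite.f_integrable PL).
apply: ge0_ae_eq_integral => //.
- exact: emeasurable_funM.
- by apply: emeasurable_funM => //; exact/measurable_EFinP.
- by move=> x _; rewrite mule_ge0// Radon_Nikodym_SigmaFinite.f_ge0.
- by move=> x _; rewrite mule_ge0// lee_fin.
apply: ae_eqe_mul2l; apply: integral_ae_eq => //.
- exact: Radon_Nikodym_SigmaFinite.f_integrable.
- exact/measurable_EFinP.
- by move=> E _ mE; rewrite -Radon_Nikodym_SigmaFinite.f_integral// fE.
Qed.

Lemma integral_density P L f (h : T -> \bar R) : has_density P L f ->
  measurable_fun [set: T] h ->
  \int[P]_x h x = \int[L]_x (h x * (f x)%:E).
Proof.
move=> Pf mh; have [mf f0 fE] := Pf.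
rewrite integralE [RHS]integralE.
rewrite (ge0_integral_density Pf); last 2 first.
- exact: measurable_funepos.
- by move=> x; exact: funepos_ge0.
rewrite (ge0_integral_density Pf); last 2 first.
- exact: measurable_funeneg.
- by move=> x; exact: funeneg_ge0.
congr (_ - _); apply: eq_integral => x _.
- by rewrite !funeposE maxe_pMl ?lee_fin// mul0e.
- by rewrite !funenegE maxe_pMl ?lee_fin// mul0e mulNe.
Qed.

Lemma dominates_has_density P L : P `<< L -> exists f, has_density P L f.
Proof.
move=> PL; pose f := Radon_Nikodym_SigmaFinite.f P L.
have mf := measurable_int _ (Radon_Nikodym_SigmaFinite.f_integrable PL).
have fE x : f x = (fine (f x))%:E.
  by rewrite fineK// Radon_Nikodym_SigmaFinite.f_fin_num.
exists (fine \o f); split.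
- by apply: measurableT_comp => //; exact: measurable_fine.
- by move=> x; rewrite /= fine_ge0// Radon_Nikodym_SigmaFinite.f_ge0.
- move=> A mA; rewrite (Radon_Nikodym_SigmaFinite.f_integral PL)//.
  by apply: eq_integral => x _; rewrite -/f fE.
Qed.

Lemma has_density_trans P L M f g : has_density P L f -> has_density L M g ->
  has_density P M (f \* g)%R.
Proof.
move=> [mf f0 fE] Lg; have [mg g0 gE] := Lg; split.
- exact: measurable_funM.
- by move=> x; rewrite mulr_ge0.
- move=> A mA; rewrite fE// integral_mkcond/= (integral_density Lg).
    rewrite [RHS]integral_mkcond/=; apply: eq_integral => x _.
    by rewrite !patchE; case: ifP => _; rewrite ?mul0e.
  apply/(measurable_restrictT _ _).1 => //.
  by apply: measurable_funTS; exact/measurable_EFinP.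
Qed.

Lemma has_density1 L : has_density L L (cst 1%R).
Proof.
by split => // A mA; rewrite -[RHS]/(\int[L]_(x in A) cst 1 x) integral_cst// mul1e.
Qed.

Lemma has_densityD P Q L f g : has_density P L f -> has_density Q L g ->
  has_density (measure_add P Q) L (f \+ g)%R.
Proof.
move=> [mf f0 fE] [mg g0 gE]; split.
- exact: measurable_funD.
- by move=> x; rewrite addr_ge0.
- move=> A mA; rewrite [LHS]measure_addE [X in X + _]fE// [X in _ + X]gE// -ge0_integralD//.
  + by move=> x _; rewrite lee_fin.
  + by apply: measurable_funTS; exact/measurable_EFinP.
  + by move=> x _; rewrite lee_fin.
  + by apply: measurable_funTS; exact/measurable_EFinP.
Qed.

Lemma measurable_density P M : P `<< M -> measurable_fun [set: T] (density P M).
Proof. by move=> PM; exact: measurableT_comp. Qed.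

Lemma has_density_density P M f : has_density P M f ->
  ae_eq M [set: T] (density P M) f.
Proof.
move=> Pf; have PM := has_density_dominates Pf; have [mf f0 fE] := Pf.
have /ae_eq_comp : ae_eq M [set: T]
    (Radon_Nikodym (charge_of_finite_measure P) M) (EFin \o f).
  apply: integral_ae_eq => //.
  - exact: Radon_Nikodym_integrable.
  - exact/measurable_EFinP.
  - by move=> E _ mE; rewrite -Radon_Nikodym_integral// -fE.
by move/(_ _ fine).
Qed.

Lemma density_factor P M L f g : P `<< M ->
  has_density P L f -> has_density M L g ->
  exists r : T -> R, [/\ measurable_fun [set: T] r, forall x, (0 <= r x)%R,
    ae_eq M [set: T] (density P M) r & {ae L, forall x, (r x * g x = f x)%R}].
Proof.
move=> PM Pf Mg; have [r Pr] := dominates_has_density PM.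
have [mr r0 _] := Pr; exists r; split => //; first exact: has_density_density.
have := has_density_unique (has_density_trans Pr Mg) Pf.
by apply: filterS => x /(_ I) [].
Qed.

Lemma measurable_divEFin f g : measurable_fun [set: T] f -> measurable_fun [set: T] g ->
  measurable_fun [set: T] (fun x => (f x)%:E / (g x)%:E).
Proof.
move=> mf mg.
rewrite (_ : (fun x => _) = (fun x => if g x == 0%R then (f x)%:E * +oo
  else (f x * (g x)^-1)%:E)); last first.
  by apply/funext => x; rewrite inver; case: ifPn => //.
apply: measurable_fun_ifT.
- apply: measurable_fun_eqr => //.
- by apply: emeasurable_funM => //; exact/measurable_EFinP.
- apply/measurable_EFinP; apply: measurable_funM => //.
  by apply: measurableT_comp => //; exact: measurable_invr.
Qed.

Lemma measurable_sqB f g : measurable_fun [set: T] f -> measurable_fun [set: T] g ->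
  measurable_fun [set: T] (fun x => ((f x - g x) ^+ 2)%R).
Proof. by move=> mf mg; apply: measurable_funX; exact: measurable_funB. Qed.

Lemma add_dominatesl P Q : P `<< (measure_add P Q : {finite_measure set T -> \bar R}).
Proof.
apply/null_content_dominatesP => A mA; rewrite [X in X = 0 -> _]measure_addE => /eqP.
by rewrite padde_eq0// => /andP[/eqP].
Qed.

Lemma add_dominatesr P Q : Q `<< (measure_add P Q : {finite_measure set T -> \bar R}).
Proof.
apply/null_content_dominatesP => A mA; rewrite [X in X = 0 -> _]measure_addE => /eqP.
by rewrite padde_eq0// => /andP[_ /eqP].
Qed.

(** The dominating measure has density h = f + g + 1 with respect to [L], and p h = f, q h = g, l h
    = 1. Hence (p - q)^2 / l times h is (p h - q h)^2 = (f - g)^2. *)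
Lemma int_sqdiff_density P Q L f g : has_density P L f -> has_density Q L g ->
  int_sqdiff P Q L = \int[L]_x ((f x - g x) ^+ 2)%:E.
Proof.
move=> Pf Qg; have [mf _ _] := Pf; have [mg _ _] := Qg.
pose PQ : {finite_measure set T -> \bar R} := measure_add P Q.
pose M : {finite_measure set T -> \bar R} := measure_add PQ L.
have ML : has_density M L (f \+ g \+ cst 1)%R.
  exact: (has_densityD (has_densityD Pf Qg) (has_density1 L)).
have PQM : PQ `<< M by exact: add_dominatesl.
have PM : P `<< M by apply: null_dominates_trans PQM; exact: add_dominatesl.
have QM : Q `<< M by apply: null_dominates_trans PQM; exact: add_dominatesr.
have LM : L `<< M by exact: add_dominatesr.
transitivity (\int[M]_x (((density P M x - density Q M x) ^+ 2)%:E / (density L M x)%:E)).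
  by [].
have [p [mp _ pE pf]] := density_factor PM Pf ML.
have [q [mq _ qE qg]] := density_factor QM Qg ML.
have [l [ml l0 lE l1]] := density_factor LM (has_density1 L) ML.
have mpql : measurable_fun [set: T] (fun x => ((p x - q x) ^+ 2)%:E / (l x)%:E).
  by apply: measurable_divEFin => //; exact: measurable_sqB.
have ge0_div (a b : R) : (0 <= b)%R -> 0 <= (a ^+ 2)%:E / b%:E.
  by move=> b0; rewrite mule_ge0 ?inve_ge0 ?lee_fin ?sqr_ge0.
transitivity (\int[M]_x (((p x - q x) ^+ 2)%:E / (l x)%:E)).
  apply: ae_eq_integral => //.
    apply: measurable_divEFin; last exact: measurable_density.
    by apply: measurable_sqB; exact: measurable_density.
  by apply: filterS3 pE qE lE => x pE qE lE _; rewrite pE// qE// lE.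
have [mh _ _] := ML.
rewrite (ge0_integral_density ML)//; last by move=> x; exact: ge0_div.
apply: ae_eq_integral => //.
- by apply: emeasurable_funM => //; exact/measurable_EFinP.
- by apply/measurable_EFinP; exact: measurable_sqB.
apply: filterS3 pf qg l1 => x <- <- lx _.
(* The relation l h = 1 rules out a zero denominator almost everywhere, so the convention on
   division by 0 does not intervene. *)
have lx0 : l x != 0%R by apply: contra_eq_neq lx => ->; rewrite mul0r eq_sym oner_neq0.
rewrite inver (negbTE lx0) -!EFinM; congr EFin.
move: lx; set h := (_ \+ _)%R x => lx.
have -> : h = (l x)^-1%R by apply: (mulfI lx0); rewrite lx divff.
by field.
Qed.

(** Common core of total variation and Hellinger distance: [G] is homogeneous of degree 1, so the
    density of [M] with respect to [L] can be absorbed into its arguments. *)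
Lemma integral_add_density P Q L f g (G : R -> R -> R) :
  (forall a b c, (0 <= a)%R -> (0 <= b)%R -> (0 <= c)%R ->
    (G a b * c = G (a * c) (b * c))%R) ->
  (forall a b, (0 <= G a b)%R) ->
  (forall u v : T -> R, measurable_fun [set: T] u -> measurable_fun [set: T] v ->
     measurable_fun [set: T] (fun x => G (u x) (v x))) ->
  has_density P L f -> has_density Q L g ->
  let M : {finite_measure set T -> \bar R} := measure_add P Q in
  \int[M]_x (G (density P M x) (density Q M x))%:E = \int[L]_x (G (f x) (g x))%:E.
Proof.
move=> GM G0 mG Pf Qg M; have [mf _ _] := Pf; have [mg _ _] := Qg.
have ML : has_density M L (f \+ g)%R by exact: has_densityD.
have PM : P `<< M by exact: add_dominatesl.
have QM : Q `<< M by exact: add_dominatesr.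
have [p [mp p0 pE pf]] := density_factor PM Pf ML.
have [q [mq q0 qE qg]] := density_factor QM Qg ML.
transitivity (\int[M]_x (G (p x) (q x))%:E).
  apply: ae_eq_integral => //.
  - by apply/measurable_EFinP; apply: mG; exact: measurable_density.
  - by apply/measurable_EFinP; exact: mG.
  - by apply: filterS2 pE qE => x pE qE _; rewrite pE// qE.
have [mh h0 _] := ML.
rewrite (ge0_integral_density ML)//; last first.
- by move=> x; rewrite lee_fin.
- by apply/measurable_EFinP; exact: mG.
apply: ae_eq_integral => //.
- by apply: emeasurable_funM; apply/measurable_EFinP => //; exact: mG.
- by apply/measurable_EFinP; exact: mG.
by apply: filterS2 pf qg => x <- <- _; rewrite -EFinM GM.
Qed.

Lemma TV_density P Q L f g : has_density P L f -> has_density Q L g ->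
  TV P Q = 2^-1%:E * \int[L]_x `|f x - g x|%:E.
Proof.
move=> Pf Qg; rewrite /TV; congr (_ * _).
apply: (integral_add_density (G := fun a b => `|a - b|%R)) Pf Qg => //.
- by move=> a b c a0 b0 c0; rewrite -mulrBl normrM (ger0_norm c0).
- move=> u v mu mv; apply: measurableT_comp => //; exact: measurable_funB.
Qed.

Lemma hellinger2_density P Q L f g : has_density P L f -> has_density Q L g ->
  hellinger2 P Q = \int[L]_x ((Num.sqrt (f x) - Num.sqrt (g x)) ^+ 2)%:E.
Proof.
move=> Pf Qg; rewrite /hellinger2.
apply: (integral_add_density (G := fun a b => (Num.sqrt a - Num.sqrt b) ^+ 2)%R) Pf Qg => //.
- move=> a b c a0 b0 c0; rewrite !sqrtrM// -mulrBl exprMn sqr_sqrtr//.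
- by move=> a b; exact: sqr_ge0.
- move=> u v mu mv; apply: measurable_sqB; apply: measurableT_comp => //; exact: measurable_sqrtr.
Qed.

(** A finite integral has an almost everywhere finite integrand. Since a / 0 = +oo for a > 0, [p]
    must vanish almost everywhere that [q] does, in particular on a [Q]-null set. *)
Lemma chi2_dominates P Q : chi2 P Q < +oo -> P `<< Q.
Proof.
pose PQ : {finite_measure set T -> \bar R} := measure_add P Q.
pose M : {finite_measure set T -> \bar R} := measure_add PQ Q.
have PQM : PQ `<< M by exact: add_dominatesl.
have PM : P `<< M by apply: null_dominates_trans PQM; exact: add_dominatesl.
have QM : Q `<< M by exact: add_dominatesr.
move=> chi2_fin; apply/null_content_dominatesP => A mA QA0.
have [p Pp] := dominates_has_density PM; have [mp p0 pE] := Pp.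
have [q Qq] := dominates_has_density QM; have [mq q0 qE] := Qq.
have hp := has_density_density Pp; have hq := has_density_density Qq.
pose h x := ((p x - q x) ^+ 2)%:E / (q x)%:E.
have mh : measurable_fun [set: T] h by apply: measurable_divEFin => //; exact: measurable_sqB.
have h0 x : 0 <= h x by rewrite /h mule_ge0 ?inve_ge0 ?lee_fin ?sqr_ge0.
have chiE : chi2 P Q = \int[M]_x h x.
  transitivity (\int[M]_x (((density P M x - density Q M x) ^+ 2)%:E / (density Q M x)%:E)).
    by [].
  apply: ae_eq_integral => //.
    apply: measurable_divEFin; last exact: measurable_density.
    by apply: measurable_sqB; exact: measurable_density.
  by apply: filterS2 hp hq => x pE' qE' _; rewrite pE'// qE'.
have h_fin : M.-integrable [set: T] h.
  apply/integrableP; split => //; under eq_integral do rewrite gee0_abs//.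
  by rewrite -chiE.
have h_ae := integrable_ae measurableT h_fin.
have q_ae : ae_eq M A (EFin \o q) (cst 0).
  apply/(ae_eq_integral_abs _ mA).
    by apply: measurable_funTS; exact/measurable_EFinP.
  under eq_integral do rewrite gee0_abs ?lee_fin//.
  by rewrite -qE.
rewrite pE// (ae_eq_integral (cst 0)) ?integral0//.
- by apply: measurable_funTS; exact/measurable_EFinP.
- apply: filterS2 q_ae h_ae => x qx hx Ax.
  have [q0x] := qx Ax; have := hx I; rewrite /h q0x subr0 inve0.
  have [p00|p00] := eqVneq (p x) 0%R; first by rewrite p00.
  rewrite gt0_muley//; last by rewrite lte_fin exprn_gt0// lt_neqAle eq_sym p00 p0.
Qed.

End has_density.

(** * Densities and integrals for mixtures and product measures *)

Section products.
Context d (T : measurableType d) (R : realType).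

Lemma has_density_unif_mixture (I : finType) (i0 : I) (P : I -> probability T R)
    (L : {finite_measure set T -> \bar R}) (f : I -> T -> R) :
  (forall i, has_density (P i) L (f i)) ->
  has_density (unif_mixture i0 P : probability T R) L
    (fun x => #|I|%:R^-1 * \sum_i f i x)%R.
Proof.
move=> Pf; split.
- apply: measurable_funM => //; apply: measurable_sum => i.
  by have [] := Pf i.
- move=> x; rewrite mulr_ge0 ?invr_ge0// sumr_ge0// => i _.
  by have [_ + _] := Pf i; apply.
- move=> A mA.
  transitivity ((#|I|%:R^-1)%:E * \sum_i P i A) => //.
  under eq_bigr => i _ do rewrite (let: And3 _ _ h := Pf i in h A mA).
  rewrite -ge0_integral_sum//; last 2 first.
  - by move=> i; apply: measurable_funTS; apply/measurable_EFinP; have [] := Pf i.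
  - by move=> i x _; rewrite lee_fin; have [_ + _] := Pf i; apply.
  rewrite -ge0_integralZl//.
  - by apply: eq_integral => x _; rewrite sumEFin EFinM.
  - apply: emeasurable_sum => i; apply: measurable_funTS.
    by apply/measurable_EFinP; have [] := Pf i.
  - by move=> x _; apply: sume_ge0 => i _; rewrite lee_fin; have [_ + _] := Pf i; apply.
Qed.

Lemma measurable_prod_tnth n (f : 'I_n -> T -> R) :
  (forall i, measurable_fun [set: T] (f i)) ->
  measurable_fun [set: n.-tuple T] (fun t => \prod_i f i (tnth t i))%R.
Proof.
move=> mf; apply: measurable_prod => i _.
by apply: (measurableT_comp (mf i)); exact: measurable_tnth.
Qed.

Lemma prod_pair_cons n (f : 'I_n.+1 -> T -> R) z :
  (\prod_i f i (tnth (pair_cons z) i) =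
   f ord0 z.1 * \prod_i f (lift ord0 i) (tnth z.2 i))%R.
Proof.
case: z => x t; rewrite big_ord_recl; congr (f _ _ * _)%R.
by apply: eq_bigr => i _; rewrite /= tnthS.
Qed.

Lemma ge0_integral_tuple_product n (P : 'I_n.+1 -> probability T R) (h : n.+1.-tuple T -> \bar R) :
  measurable_fun [set: _] h -> (forall t, 0 <= h t) ->
  \int[tuple_product P]_t h t =
  \int[P ord0]_x \int[tuple_product (fun i => P (lift ord0 i))]_t h (pair_cons (x, t)).
Proof.
move=> mh h0; rewrite /= ge0_integral_distribution//.
by rewrite fubini_tonelli1//; [exact: measurableT_comp|move=> x; exact: h0].
Qed.

Lemma ge0_integral_tuple_product_density n (P Q : 'I_n -> probability T R)
    (f : 'I_n -> T -> R) (h : n.-tuple T -> \bar R) :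
  (forall i, has_density (P i) (Q i) (f i)) ->
  measurable_fun [set: n.-tuple T] h -> (forall t, 0 <= h t) ->
  \int[tuple_product P]_t h t =
  \int[tuple_product Q]_t (h t * (\prod_i f i (tnth t i))%:E).
Proof.
elim: n P Q f h => [|n IH] P Q f h Pf mh h0.
  by under [RHS]eq_integral do rewrite big_ord0 mule1.
have mf i : measurable_fun [set: T] (f i) by have [] := Pf i.
have f0 i x : (0 <= f i x)%R by have [_ + _] := Pf i; apply.
have mprod : measurable_fun [set: n.+1.-tuple T]
    (fun t => (\prod_i f i (tnth t i))%:E).
  by apply/measurable_EFinP; exact: measurable_prod_tnth.
have prod0 m (g : 'I_m -> T -> R) (t : m.-tuple T) : (forall i x, 0 <= g i x)%R ->
    0 <= (\prod_i g i (tnth t i))%:E.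
  by move=> g0; rewrite lee_fin prodr_ge0.
rewrite !ge0_integral_tuple_product//; last 2 first.
- exact: emeasurable_funM.
- by move=> t; rewrite mule_ge0// prod0.
have mhx x : measurable_fun [set: n.-tuple T] (fun t => h (pair_cons (x, t))).
  apply: (measurableT_comp mh); apply: measurableT_comp => //.
have mh2 : measurable_fun [set: T * n.-tuple T] (h \o @pair_cons _ T n).
  exact: measurableT_comp.
rewrite (ge0_integral_density (Pf ord0)); last 2 first.
- apply: (measurable_fun_fubini_tonelli_F (h \o @pair_cons _ T n)) => //.
  by move=> x; exact: h0.
- by move=> x; exact: integral_ge0.
apply: eq_integral => x _.
rewrite (IH _ (fun i => Q (lift ord0 i)) (fun i => f (lift ord0 i)))//.
rewrite muleC -ge0_integralZl//.
- apply: eq_integral => t _; rewrite prod_pair_cons EFinM/=.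
  by rewrite muleCA.
- apply: emeasurable_funM => //; apply/measurable_EFinP.
  exact: (@measurable_prod_tnth n (fun i => f (lift ord0 i)) (fun i => mf _)).
- move=> t _; rewrite mule_ge0//.
  by apply: (prod0 n (fun i => f (lift ord0 i))) => i y; exact: f0.
- by rewrite lee_fin.
Qed.

Lemma has_density_tuple_product n (P Q : 'I_n -> probability T R)
    (f : 'I_n -> T -> R) :
  (forall i, has_density (P i) (Q i) (f i)) ->
  has_density (tuple_product P) (tuple_product Q)
    (fun t => \prod_i f i (tnth t i))%R.
Proof.
move=> Pf.
have mf i : measurable_fun [set: T] (f i) by have [] := Pf i.
split.
- exact: measurable_prod_tnth.
- by move=> t; apply: prodr_ge0 => i _; have [_ + _] := Pf i; apply.
- move=> A mA; rewrite -[LHS]mul1e -integral_cst// integral_mkcond.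
  rewrite (ge0_integral_tuple_product_density Pf).
  + rewrite [RHS]integral_mkcond; apply: eq_integral => t _.
    by rewrite !patchE; case: ifPn => _; rewrite ?mul1e ?mul0e.
  + by apply/(measurable_restrictT _ _).1.
  + by move=> t; rewrite patchE; case: ifPn.
Qed.

(** Tonelli settles nonnegative factors; applied to the absolute values, it gives the integrability
    that Fubini requires for signed factors. *)
Lemma integral_prod_tuple n (Q : 'I_n -> probability T R) (f : 'I_n -> T -> R) :
  (forall i, (Q i).-integrable [set: T] (EFin \o f i)) ->
  (tuple_product Q).-integrable [set: _] (fun t => (\prod_i f i (tnth t i))%:E) /\
  \int[tuple_product Q]_t (\prod_i f i (tnth t i))%:E =
  (\prod_i \int[Q i]_x f i x)%R%:E.
Proof.
move=> intf.
have mf n' (Q' : 'I_n' -> probability T R) (f' : 'I_n' -> T -> R) :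
  (forall i, (Q' i).-integrable [set: T] (EFin \o f' i)) ->
  forall i, measurable_fun [set: T] (f' i).
  by move=> h i; have /measurable_int/measurable_EFinP := h i.
have ge0 n' (Q' : 'I_n' -> probability T R) (f' : 'I_n' -> T -> R) :
  (forall i x, 0 <= f' i x)%R ->
  (forall i, (Q' i).-integrable [set: T] (EFin \o f' i)) ->
  \int[tuple_product Q']_t (\prod_i f' i (tnth t i))%:E =
  (\prod_i \int[Q' i]_x f' i x)%R%:E.
  elim: n' Q' f' => [|m IH] Q' f' f'0 intf'.
    under eq_integral do rewrite big_ord0.
    by rewrite big_ord0 integral_cst// [X in _ * X](_ : _ = 1) ?mule1//; exact: probability_setT.
  have mp := @measurable_prod_tnth m (fun i => f' (lift ord0 i))
    (fun i => mf _ _ _ intf' (lift ord0 i)).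
  rewrite ge0_integral_tuple_product//; last 2 first.
  - by apply/measurable_EFinP; apply: measurable_prod_tnth; exact: mf intf'.
  - by move=> t; rewrite lee_fin prodr_ge0.
  under eq_integral => x _.
    under eq_integral do rewrite prod_pair_cons EFinM/=.
    rewrite ge0_integralZl//; last 3 first.
    - exact/measurable_EFinP.
    - by move=> t _; rewrite lee_fin prodr_ge0.
    - by rewrite lee_fin.
    rewrite (IH (fun i => Q' (lift ord0 i)) (fun i => f' (lift ord0 i)))//.
    over.
  rewrite ge0_integralZr//; last 3 first.
  - by apply/measurable_EFinP; exact: mf intf' _.
  - by move=> x _; rewrite lee_fin.
  - by rewrite lee_fin prodr_ge0// => i _; apply: Rintegral_ge0.
  rewrite big_ord_recl EFinM; congr (_ * _).
  by rewrite /Rintegral fineK//; apply: integrable_fin_num => //; exact: (intf' ord0).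
have integ n' (Q' : 'I_n' -> probability T R) (f' : 'I_n' -> T -> R) :
  (forall i, (Q' i).-integrable [set: T] (EFin \o f' i)) ->
  (tuple_product Q').-integrable [set: _] (fun t => (\prod_i f' i (tnth t i))%:E).
  move=> intf'; apply/integrableP; split.
    by apply/measurable_EFinP; apply: measurable_prod_tnth; exact: mf intf'.
  under eq_integral do rewrite abse_EFin normr_prod.
  rewrite (ge0 _ _ (fun i x => `|f' i x|%R)) ?ltry// => i.
  exact: integrable_norm (intf' i).
split; first exact: integ.
elim: n Q f intf => [|m IH] Q f intf.
  under eq_integral do rewrite big_ord0.
  by rewrite big_ord0 integral_cst// [X in _ * X](_ : _ = 1) ?mule1//; exact: probability_setT.
have intprod := integ _ _ _ intf.
have mprod : measurable_fun [set: _] (fun t : m.+1.-tuple T => (\prod_i f i (tnth t i))%:E).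
  exact: measurable_int intprod.
pose tp := tuple_product (fun i => Q (lift ord0 i)).
have intpair : (Q ord0 \x tp).-integrable [set: _]
    ((fun t => (\prod_i f i (tnth t i))%:E) \o @pair_cons _ T m).
  apply/integrableP; split; first exact: measurableT_comp.
  have /integrableP[_] := intprod.
  rewrite /= ge0_integral_distribution//=; apply/measurable_EFinP.
  by apply: measurableT_comp => //; exact/measurable_EFinP.
rewrite /= integral_distribution//.
rewrite -integral12_prod_meas1//.
transitivity (\int[Q ord0]_x ((f ord0 x)%:E * (\prod_i \int[Q (lift ord0 i)]_x f (lift ord0 i) x)%R%:E)).
  apply: eq_integral => x _.
  transitivity (\int[tp]_t ((f ord0 x)%:E * (\prod_i f (lift ord0 i) (tnth t i))%:E)).
    by apply: eq_integral => t _; rewrite /= prod_pair_cons EFinM.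
  rewrite integralZl//; last exact: (integ _ _ (fun i => f (lift ord0 i))).
  by rewrite (IH _ (fun i => f (lift ord0 i))).
rewrite integralZr//; last exact: (intf ord0).
rewrite big_ord_recl EFinM; congr (_ * _).
by rewrite /Rintegral fineK//; apply: integrable_fin_num => //; exact: (intf ord0).
Qed.

End products.

(** * Gram matrices of square-integrable functions *)

Local Open Scope ring_scope.

(** Compare the Laplacian forms, the sums of weights times (u_i - u_j)^2, of [M] and of the constant
    matrix [eps]: u M u <= m (1 - eps) |u|^2 + eps (sum u)^2. Subtracting (sum u)^2 leaves a
    nonpositive multiple of it, as eps <= 1. *)
Lemma spectral_gap_le (R : realFieldType) (m : nat) (M : 'I_m -> 'I_m -> R) (eps : R) u :
  (forall i j, M i j = M j i) -> (forall i, \sum_j M i j = m%:R) ->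
  (forall i j, i != j -> eps <= M i j) -> eps <= 1 ->
  \sum_i \sum_j u i * u j * (M i j - 1) <= m%:R * (1 - eps) * \sum_i u i ^+ 2.
Proof.
move=> symM sumM epsM eps1.
pose S2 := \sum_i u i ^+ 2; pose S1 := \sum_i u i.
have S1E : \sum_i \sum_j u i * u j = S1 ^+ 2.
  rewrite expr2 {1}/S1 mulr_suml; apply: eq_bigr => i _.
  by rewrite mulr_sumr.
have expand (M' : 'I_m -> 'I_m -> R) c : (forall i j, M' i j = M' j i) ->
    (forall i, \sum_j M' i j = c) ->
    \sum_i \sum_j M' i j * (u i - u j) ^+ 2 =
    2 * (c * S2 - \sum_i \sum_j u i * u j * M' i j).
  move=> symM' sumM'.
  have h1 : \sum_i \sum_j M' i j * u i ^+ 2 = c * S2.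
    by rewrite mulr_sumr; apply: eq_bigr => i _; rewrite -mulr_suml sumM'.
  have h2 : \sum_i \sum_j M' i j * u j ^+ 2 = c * S2.
    rewrite exchange_big/= -h1; apply: eq_bigr => i _.
    by apply: eq_bigr => j _; rewrite symM'.
  rewrite mulrBr [2 * (c * S2)]mulr_natl mulr2n -{1}h1 -h2 mulr_sumr.
  rewrite -big_split -sumrB; apply: eq_bigr => i _ /=.
  rewrite mulr_sumr -big_split -sumrB; apply: eq_bigr => j _ /=.
  by ring.
have e1 := expand M _ symM sumM.
have e2 := expand (fun _ _ => eps) (m%:R * eps) (fun _ _ => erefl)
  (fun i => etrans (sumr_const _ _) (etrans (congr1 (GRing.natmul eps) (card_ord m)) (esym (mulr_natl eps m)))).
have le12 : \sum_i \sum_j eps * (u i - u j) ^+ 2 <= \sum_i \sum_j M i j * (u i - u j) ^+ 2.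
  apply: ler_sum => i _; apply: ler_sum => j _.
  (* Diagonal weights do not enter the Laplacian form, so the off-diagonal bound is enough. *)
  have [->|ij] := eqVneq i j; first by rewrite subrr expr0n !mulr0.
  by rewrite ler_wpM2r ?sqr_ge0// epsM.
rewrite e1 e2 in le12.
have e3 : \sum_i \sum_j u i * u j * eps = S1 ^+ 2 * eps.
  by rewrite -S1E mulr_suml; apply: eq_bigr => i _; rewrite mulr_suml.
rewrite e3 in le12.
have -> : \sum_i \sum_j u i * u j * (M i j - 1) =
    \sum_i \sum_j u i * u j * M i j - S1 ^+ 2.
  rewrite -S1E -sumrB; apply: eq_bigr => i _; rewrite -sumrB.
  by apply: eq_bigr => j _; rewrite mulrBr mulr1.
have : 0 <= (1 - eps) * S1 ^+ 2 by rewrite mulr_ge0 ?sqr_ge0// subr_ge0.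
by rewrite -/S2; lra.
Qed.

(** * Square-integrable functions and their inner product *)

Section square_integrable.
Context d (T : measurableType d) (R : realType) (Q : probability T R).
Implicit Types f g : T -> R.

Definition sqint f := measurable_fun [set: T] f /\
  Q.-integrable [set: T] (EFin \o (fun x => f x ^+ 2)).

Definition dotL2 f g : R := \int[Q]_x (f x * g x).

Lemma sqint_mul f g : sqint f -> sqint g -> Q.-integrable [set: T] (EFin \o (f \* g)).
Proof.
move=> [mf if2] [mg ig2].
apply: (@le_integrable _ _ _ _ _ measurableT _ (fun x => ((f x ^+ 2)%:E + (g x ^+ 2)%:E)%E)).
- by apply/measurable_EFinP; exact: measurable_funM.
- move=> x _; rewrite -EFinD lee_fin normrM [leRHS]ger0_norm; last first.
    by rewrite addr_ge0// sqr_ge0.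
  rewrite -(real_normK (num_real (f x))) -(real_normK (num_real (g x))).
  have := sqr_ge0 (`|f x| - `|g x|); have := sqr_ge0 (`|f x| + `|g x|).
  by rewrite sqrrB sqrrD; lra.
- exact: integrableD.
Qed.

Lemma sqint_cst c : sqint (cst c).
Proof. by split => //; exact: (finite_measure_integrable_cst _ (c ^+ 2)). Qed.

Lemma sqintD f g : sqint f -> sqint g -> sqint (f \+ g).
Proof.
move=> hf hg; have ifg := sqint_mul hf hg.
case: hf hg => [mf if2] [mg ig2]; split; first exact: measurable_funD.
rewrite (_ : _ \o _ = (fun x => ((f x ^+ 2)%:E + (g x ^+ 2)%:E
    + (2%:E * (EFin \o (f \* g)%R) x))%E)); last first.
  by apply/funext => x /=; rewrite -EFinM -!EFinD; congr EFin; ring.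
by apply: integrableD => //; [exact: integrableD|exact: integrableZl].
Qed.

Lemma sqintZ c f : sqint f -> sqint (fun x => c * f x).
Proof.
move=> [mf if2]; split; first exact: measurable_funM.
rewrite (_ : _ \o _ = (fun x => (c ^+ 2)%:E * (EFin \o (fun x => f x ^+ 2)%R) x)%E).
  exact: integrableZl.
by apply/funext => x /=; rewrite -EFinM exprMn.
Qed.

Lemma sqintB f g : sqint f -> sqint g -> sqint (f \- g).
Proof.
move=> hf hg; rewrite (_ : f \- g = f \+ (fun x => -1 * g x)); last first.
  by apply/funext => x /=; rewrite mulN1r.
by apply: sqintD => //; exact: sqintZ.
Qed.

Lemma sqint_sum (I : Type) (r : seq I) (f : I -> T -> R) :
  (forall i, sqint (f i)) -> sqint (fun x => \sum_(i <- r) f i x).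
Proof.
move=> hf; elim: r => [|i r IH].
  by under eq_fun do rewrite big_nil; exact: sqint_cst.
by under eq_fun do rewrite big_cons; exact: sqintD.
Qed.

Lemma dotL2C f g : dotL2 f g = dotL2 g f.
Proof. by apply: eq_Rintegral => x _; rewrite mulrC. Qed.

Lemma dotL2Dr f g h : sqint f -> sqint g -> sqint h ->
  dotL2 f (g \+ h) = dotL2 f g + dotL2 f h.
Proof.
move=> hf hg hh; rewrite /dotL2 -RintegralD//; [|exact: sqint_mul..].
by apply: eq_Rintegral => x _; rewrite mulrDr.
Qed.

Lemma dotL2Zr f c g : sqint f -> sqint g ->
  dotL2 f (fun x => c * g x) = c * dotL2 f g.
Proof.
move=> hf hg; rewrite /dotL2 -RintegralZl//; last exact: sqint_mul.
by apply: eq_Rintegral => x _; rewrite mulrCA.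
Qed.

Lemma dotL2Br f g h : sqint f -> sqint g -> sqint h ->
  dotL2 f (g \- h) = dotL2 f g - dotL2 f h.
Proof.
move=> hf hg hh; rewrite /dotL2 -RintegralB//; [|exact: sqint_mul..].
by apply: eq_Rintegral => x _; rewrite mulrBr.
Qed.

Lemma dotL2_sumr (I : Type) (r : seq I) f (g : I -> T -> R) : sqint f ->
  (forall i, sqint (g i)) ->
  dotL2 f (fun x => \sum_(i <- r) g i x) = \sum_(i <- r) dotL2 f (g i).
Proof.
move=> hf hg; elim: r => [|i r IH].
  rewrite big_nil /dotL2; under eq_Rintegral do rewrite big_nil mulr0.
  by rewrite Rintegral_cst// mul0r.
rewrite big_cons -IH -dotL2Dr//; last exact: sqint_sum.
by apply: eq_Rintegral => x _; rewrite big_cons.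
Qed.

Lemma dotL2_ge0 f : 0 <= dotL2 f f.
Proof. by apply: Rintegral_ge0 => x _; rewrite -expr2 sqr_ge0. Qed.

Lemma dotL2_CS f g : sqint f -> sqint g ->
  dotL2 f g ^+ 2 <= dotL2 f f * dotL2 g g.
Proof.
move=> hf hg.
have key (a b : R) : 0 <= a ^+ 2 * dotL2 f f - 2 * a * b * dotL2 f g + b ^+ 2 * dotL2 g g.
  have := dotL2_ge0 ((fun x => a * f x) \- (fun x => b * g x)).
  rewrite dotL2Br ?(dotL2C (_ \- _)) ?dotL2Br; try exact: sqintZ; last first.
  - by apply: sqintB; exact: sqintZ.
  rewrite !dotL2Zr ?(dotL2C (fun x => _ * _)) ?dotL2Zr//; try exact: sqintZ.
  by rewrite (dotL2C g f); lra.
have [g0|gn0] := eqVneq (dotL2 g g) 0.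
  (* These coefficients turn the form into minus the square of [dotL2 f g], which must therefore
     vanish. *)
  rewrite g0 mulr0; have := key (dotL2 f g) ((dotL2 f f + 1) / 2 * 1).
  have [fg0|fgn0] := eqVneq (dotL2 f g) 0; first by rewrite fg0 expr0n.
  rewrite g0 mulr0 addr0; have : 0 < dotL2 f g ^+ 2 by rewrite exprn_even_gt0.
  set x := dotL2 f g ^+ 2 => x0.
  rewrite (_ : _ - _ = - x); last by rewrite /x; field.
  by lra.
have ggt0 : 0 < dotL2 g g by rewrite lt_neqAle eq_sym gn0 dotL2_ge0.
have := key (dotL2 g g) (dotL2 f g).
rewrite (_ : _ + _ = dotL2 g g * (dotL2 f f * dotL2 g g - dotL2 f g ^+ 2)); last by ring.
by rewrite pmulr_rge0// subr_ge0.
Qed.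

End square_integrable.

(** * The permanent bound for functions in L^2 *)

Section gram_L2.
Context d (T : measurableType d) (R : realType) (Q : probability T R).
Variables (m : nat) (g : T -> R) (f : 'I_m.+1 -> T -> R) (eps : R).
Local Notation dot := (dotL2 Q).
Local Notation sqint := (sqint Q).

Definition ordcons (i : 'I_m.+2) : T -> R := if unlift ord0 i is Some j then f j else g.

Lemma ordcons0 : ordcons ord0 = g. Proof. by rewrite /ordcons unlift_none. Qed.

Lemma ordconsS i : ordcons (lift ord0 i) = f i. Proof. by rewrite /ordcons liftK. Qed.

Hypotheses (hg : sqint g) (hf : forall i, sqint (f i)).
Hypothesis g_mean : dot g (cst 1) = 0.
Hypothesis f_mean : forall i, dot (f i) (cst 1) = 1.
Hypothesis f_sum : {ae Q, forall x, \sum_i f i x = m.+1%:R}.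
Hypothesis eps_le : forall i j, i != j -> eps <= dot (f i) (f j).
Hypotheses (eps_gt0 : 0 < eps) (eps_le1 : eps <= 1).

Let A i j := dot (ordcons i) (ordcons j).
Let C := m.+1%:R^-1 * \sum_i (dot (f i) (f i) - 1).

Lemma sqint_ordcons i : sqint (ordcons i).
Proof. by rewrite /ordcons; case: unlift. Qed.

Let b (i : 'I_m.+2) (x : T) := ordcons i x - (i != ord0)%:R.

Let hb i : sqint (b i).
Proof. by apply: sqintB; [exact: sqint_ordcons|exact: sqint_cst]. Qed.

Let mean i : dot (ordcons i) (cst 1) = (i != ord0)%:R.
Proof. by case: (unliftP ord0 i) => [j|] ->; rewrite ?ordconsS ?ordcons0 ?f_mean ?g_mean. Qed.

Let dot11 : dot (cst 1) (cst 1) = 1.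
Proof.
rewrite /dotL2 (@eq_Rintegral _ _ _ Q setT (cst 1)) => [|x _]; last by rewrite mulr1.
by rewrite Rintegral_cst// mul1r [X in fine X](_ : _ = 1%E)//; exact: probability_setT.
Qed.

Let dot_cst h c : sqint h -> dot h (cst c) = c * dot h (cst 1).
Proof.
move=> hh; rewrite -dotL2Zr//; last exact: sqint_cst.
by apply: eq_Rintegral => x _ /=; rewrite mulr1.
Qed.

Let BE i j : A i j - ((i != ord0) && (j != ord0))%:R = dot (b i) (b j).
Proof.
have hc c := sqint_cst Q c.
have bR h k : sqint h -> dot h (b k) = dot h (ordcons k) - (k != ord0)%:R * dot h (cst 1).
  move=> hh; rewrite -dot_cst//.
  by apply: (dotL2Br hh (sqint_ordcons k) (hc _)).
rewrite bR// (dotL2C Q (b i) (ordcons j)) (dotL2C Q (b i) (cst 1)).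
rewrite !bR//; last exact: sqint_ordcons.
rewrite dot11 (dotL2C Q (cst 1)) !mean (dotL2C Q (ordcons j)) -/(A i j).
by case: (i != _); case: (j != _); rewrite /= ?mulr0n; ring.
Qed.

Let sum_b x : \sum_i f i x = m.+1%:R -> \sum_i b (lift ord0 i) x = 0.
Proof.
move=> fx; rewrite sumrB; under eq_bigr do rewrite ordconsS.
by rewrite fx sumr_const card_ord subrr.
Qed.

Let row_sum i : \sum_j dot (b i) (b (lift ord0 j)) = 0.
Proof.
rewrite -dotL2_sumr// /dotL2 /Rintegral (ae_eq_integral (cst 0%E)) ?integral0//.
- apply/measurable_EFinP; apply: measurable_funM; first by have [] := hb i.
  by apply: measurable_sum => j; have [] := hb (lift ord0 j).
- by apply: filterS f_sum => x /sum_b -> _; rewrite mulr0.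
Qed.

(** The [f i] sum to the constant m + 1 almost everywhere. So the centred functions sum to 0 and the
    matrix of the [dot (f i) (f j)] has row sums m + 1, which lets [spectral_gap_le] convert [eps]
    into an operator bound. *)
Lemma permanent_L2_le : Fock.permanent A <=
  dot g g * (m.+1`!)%:R * expR (3 * C * (1 - ln eps)).
Proof.
have mpos : (0 < m.+1)%N by [].
have symA i j : A i j = A j i by exact: dotL2C.
have A0 : A ord0 ord0 = dot g g by rewrite /A ordcons0.
have BS i j : A (lift ord0 i) (lift ord0 j) - ((lift ord0 i != ord0) && (lift ord0 j != ord0))%:R
   = dot (f i) (f j) - 1 by rewrite /A !ordconsS.
rewrite -A0; apply: gram_permanent_exp => //.
- move=> u; under eq_bigr do under eq_bigr do rewrite BE.
  have -> : \sum_i \sum_j u i * u j * dot (b i) (b j) =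
      dot (fun x => \sum_i u i * b i x) (fun x => \sum_i u i * b i x).
    rewrite dotL2_sumr; last 2 first.
    - by apply: sqint_sum => i; exact: sqintZ.
    - by move=> i; exact: sqintZ.
    apply: eq_bigr => i _; rewrite dotL2C dotL2_sumr; last 2 first.
    - exact: sqintZ.
    - by move=> j; exact: sqintZ.
    apply: eq_bigr => j _; rewrite dotL2Zr//; last exact: sqintZ.
    rewrite -mulrA mulrCA; congr (_ * _).
    by rewrite [RHS]dotL2C dotL2Zr// dotL2C.
  exact: dotL2_ge0.
- by move=> i; under eq_bigr do rewrite BE.
- under eq_bigr do rewrite BS.
  by rewrite /C mulrA divff ?mul1r// pnatr_eq0.
- move=> u; under eq_bigr do under eq_bigr do rewrite BS.
  apply: spectral_gap_le => //; first by move=> i j; exact: dotL2C.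
  move=> i; apply/eqP; rewrite -subr_eq0; apply/eqP.
  have := row_sum (lift ord0 i); under eq_bigr do rewrite -BE BS.
  by rewrite sumrB sumr_const card_ord.
- by rewrite A0; exact: dotL2_ge0.
Qed.

End gram_L2.

(** * Symmetrized products of densities *)

Section permprod.
Context d (T : measurableType d) (R : realType) (Q : probability T R) (n : nat).
Implicit Types (f : 'I_n -> T -> R) (s : 'S_n).

Let Qn : probability (n.-tuple T) R := tuple_product (fun=> Q).

Definition permprod f s (t : n.-tuple T) : R := \prod_i f (s i) (tnth t i).

Definition permavg f (t : n.-tuple T) : R := (n`!)%:R^-1 * \sum_s permprod f s t.

Lemma integral_permprod_mul f s s' : (forall i, sqint Q (f i)) ->
  Qn.-integrable [set: _] (EFin \o (permprod f s \* permprod f s')) /\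
  dotL2 Qn (permprod f s) (permprod f s') = \prod_i dotL2 Q (f (s i)) (f (s' i)).
Proof.
move=> hf.
have e : (EFin \o (permprod f s \* permprod f s')) =
    (fun t => (\prod_i (f (s i) \* f (s' i)) (tnth t i))%:E).
  by apply/funext => t /=; rewrite -big_split.
have [] := @integral_prod_tuple _ _ _ n (fun=> Q) (fun i => f (s i) \* f (s' i)).
  by move=> i; exact: sqint_mul.
move=> h1 h2; split; first by rewrite e.
rewrite /dotL2 /Rintegral.
rewrite (eq_integral (fun t => (\prod_i (f (s i) \* f (s' i)) (tnth t i))%:E)) ?h2//.
by move=> t _; rewrite -big_split.
Qed.

Lemma sqint_permprod f s : (forall i, sqint Q (f i)) -> sqint Qn (permprod f s).
Proof.
move=> hf; split.
  by apply: (measurable_prod_tnth (f := fun i => f (s i))) => i; have [] := hf (s i).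
by have [] := integral_permprod_mul s s hf.
Qed.

Lemma sqint_permavg f : (forall i, sqint Q (f i)) -> sqint Qn (permavg f).
Proof.
by move=> hf; apply: sqintZ; apply: sqint_sum => s; exact: sqint_permprod.
Qed.

(** The inner product of the terms of [s] and [s'] depends only on the relative permutation s^-1 s',
    so the double sum is n! times one permanent and a single 1 / n! remains. *)
Lemma dotL2_permavg f : (forall i, sqint Q (f i)) ->
  dotL2 Qn (permavg f) (permavg f) =
  (n`!)%:R^-1 * Fock.permanent (fun i j => dotL2 Q (f i) (f j)).
Proof.
move=> hf; have hs := sqint_permprod _ hf.
have hS : sqint Qn (fun t => \sum_s permprod f s t) by exact: sqint_sum.
have hSZ : sqint Qn (permavg f) by exact: sqint_permavg.
rewrite {2}/permavg dotL2Zr//; congr (_ * _).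
rewrite dotL2C /permavg dotL2Zr// dotL2_sumr//.
have sumE s : dotL2 Qn (fun t => \sum_s permprod f s t) (permprod f s) =
    Fock.permanent (fun i j => dotL2 Q (f i) (f j)).
  rewrite dotL2C dotL2_sumr// /Fock.permanent.
  rewrite (reindex_inj (mulgI s)); apply: eq_bigr => s' _ /=.
  have [_ ->] := integral_permprod_mul s (s * s')%g hf.
  rewrite (reindex_inj (@perm_inj _ s^-1)); apply: eq_bigr => i _.
  by rewrite permM permKV.
rewrite (eq_bigr (fun=> Fock.permanent (fun i j => dotL2 Q (f i) (f j)))); last by move=> s _.
by rewrite sumr_const card_Sn -[X in _ * X]mulr_natl mulKf// pnatr_eq0 -lt0n fact_gt0.
Qed.

Lemma has_density_perm_mixture (P : 'I_n -> probability T R) f :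
  (forall i, has_density (P i) Q (f i)) ->
  has_density (perm_mixture P) Qn (permavg f).
Proof.
move=> Pf; rewrite (_ : permavg f = (fun t => #|'S_n|%:R^-1 * \sum_s permprod f s t)).
  apply: has_density_unif_mixture => s.
  exact: (has_density_tuple_product (fun i => Pf (s i))).
by apply/funext => t; rewrite card_Sn.
Qed.

End permprod.

(** Multilinearity: every product contains exactly one factor of index 0, at the position s^-1 0. *)
Lemma permavgB d (T : measurableType d) (R : realType) (n : nat)
    (f : 'I_n.+2 -> T -> R) (f0 : T -> R) t :
  permavg f t - permavg (fun i => if i == ord0 then f0 else f i) t =
  permavg (ordcons (f ord0 \- f0) (fun i => f (lift ord0 i))) t.
Proof.
rewrite /permavg -mulrBr -sumrB; congr (_ * _); apply: eq_bigr => s _.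
pose i0 := (s^-1)%g ord0; have si0 : s i0 = ord0 by rewrite permKV.
rewrite /permprod (bigD1 i0)//= [X in _ - X](bigD1 i0)//= [RHS](bigD1 i0)//=.
rewrite si0 eqxx ordcons0 mulrBl.
have neq i : i != i0 -> exists j, s i = lift ord0 j.
  move=> ii0; case: (unliftP ord0 (s i)) => [j ->|si]; first by exists j.
  by move: ii0; rewrite -(inj_eq (@perm_inj _ s)) si si0 eqxx.
congr (_ * _ - _ * _); apply: eq_bigr => i /neq [j ->].
- by rewrite ordconsS.
- by rewrite ordconsS.
Qed.

(** * The parameters of the family *)

Local Open Scope ereal_scope.

(** Jensen's inequality for the square: y - 1 is the mean of the r_i - 1 with weights f_i / m, and
    the variance is nonnegative. *)
Lemma weighted_sq_le (R : realFieldType) (m : nat) (f r : 'I_m -> R) (y : R) :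
  (forall i, 0 <= f i)%R -> (\sum_i f i = m%:R)%R ->
  (\sum_i f i * (r i - 1) = m%:R * (y - 1))%R ->
  (m%:R * (y - 1) ^+ 2 <= \sum_i f i * (r i - 1) ^+ 2)%R.
Proof.
move=> f0 fm fr.
have : (0 <= \sum_i f i * ((r i - 1) - (y - 1)) ^+ 2)%R.
  by apply: sumr_ge0 => i _; rewrite mulr_ge0// sqr_ge0.
have -> : (\sum_i f i * ((r i - 1) - (y - 1)) ^+ 2 =
  \sum_i f i * (r i - 1) ^+ 2 - 2 * (y - 1) * (\sum_i f i * (r i - 1))
   + (y - 1) ^+ 2 * \sum_i f i)%R.
  rewrite !mulr_sumr -sumrB -big_split; apply: eq_bigr => i _ /=; ring.
by rewrite fm fr; lra.
Qed.

(** * Chi-square divergence from a uniform mixture *)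

Section chi2_mixture.
Context d (T : measurableType d) (R : realType) (m : nat).
Variable P : 'I_m.+1 -> probability T R.
Let Q : probability T R := unif_mixture (ord0 : 'I_m.+1) P.

Lemma unif_mixture_dominates i : P i `<< Q.
Proof.
apply/null_content_dominatesP => A mA.
rewrite [X in X = 0 -> _](_ : _ = (#|'I_m.+1|%:R^-1)%:E * \sum_i P i A)//.
move=> /eqP; rewrite mule_eq0 eqe invr_eq0 pnatr_eq0 card_ord/=.
rewrite (bigD1 i)//= padde_eq0//; last by apply: sume_ge0.
by move=> /andP[/eqP].
Qed.

Variable f : 'I_m.+1 -> T -> R.
Hypothesis Pf : forall i, has_density (P i) Q (f i).

Lemma sum_density_unif_mixture : {ae Q, forall x, (\sum_i f i x = m.+1%:R)%R}.
Proof.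
have h := has_density_unif_mixture (ord0 : 'I_m.+1) Pf.
have := has_density_unique h (has_density1 Q).
apply: filterS => x /(_ I) [] /eqP; rewrite card_ord.
rewrite -(inj_eq (@mulfI _ (m.+1%:R : R) _)) ?pnatr_eq0// mulrA divff ?pnatr_eq0//.
by rewrite mul1r mulr1 => /eqP.
Qed.

(** Convexity of the divergence in its second argument. As phi = r_i f_i for every i and the f_i sum
    to m + 1, phi - 1 is the mean of the r_i - 1 with weights f_i / (m + 1), and [weighted_sq_le]
    applies pointwise. *)
Lemma chi2_unif_mixture_le (P' : probability T R) (phi : T -> R) (D : R) :
  (forall i, chi2 P' (P i) <= D%:E) -> has_density P' Q phi ->
  \int[Q]_x ((phi x - 1) ^+ 2)%:E <= D%:E.
Proof.
move=> chiD Qphi; have [mphi phi0 _] := Qphi.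
have mf i : measurable_fun [set: T] (f i) by have [] := Pf i.
have f0 i x : (0 <= f i x)%R by have [_ + _] := Pf i; apply.
have dom i : P' `<< P i by apply: chi2_dominates; exact: le_lt_trans (chiD i) (ltry _).
have /choice[r hr] i := dominates_has_density (dom i).
have mr i : measurable_fun [set: T] (r i) by have [] := hr i.
have chiE i : \int[Q]_x ((f i x * (r i x - 1) ^+ 2)%R)%:E <= D%:E.
  rewrite (le_trans _ (chiD i))// /chi2.
  rewrite (int_sqdiff_density (hr i) (has_density1 (P i))).
  rewrite (ge0_integral_density (Pf i)).
  - by under [leRHS]eq_integral do rewrite -EFinM mulrC.
  - by apply/measurable_EFinP; exact: measurable_sqB.
  - by move=> x; rewrite lee_fin sqr_ge0.
have mfr i : measurable_fun [set: T] (fun x => (f i x * (r i x - 1) ^+ 2)%R).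
  by apply: measurable_funM => //; exact: measurable_sqB.
have phiE i : {ae Q, forall x, (phi x = r i x * f i x)%R}.
  have := has_density_unique Qphi (has_density_trans (hr i) (Pf i)).
  by apply: filterS => x /(_ I) [].
have phi_ae : {ae Q, forall x, forall i, (phi x = r i x * f i x)%R}.
  have : {ae Q, forall x, forall i, i \in enum 'I_m.+1 -> (phi x = r i x * f i x)%R}.
    elim: (enum _) => [|i s IH]; first by apply: aeW.
    apply: filterS2 (phiE i) IH => x hi hs j; rewrite inE => /orP[/eqP -> //|].
    exact: hs.
  by apply: filterS => x hx i; apply: hx; rewrite mem_enum.
have m0 : (0 < m.+1%:R :> R)%R by [].
have msum : measurable_fun [set: T]
    (fun x => (m.+1%:R^-1)%:E * \sum_i (f i x * (r i x - 1) ^+ 2)%:E).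
  apply: emeasurable_funM => //; apply: emeasurable_sum => i.
  exact/measurable_EFinP.
have fr0 i x : 0 <= (f i x * (r i x - 1) ^+ 2)%:E.
  by rewrite lee_fin mulr_ge0// sqr_ge0.
apply: (@le_trans _ _ (\int[Q]_x ((m.+1%:R^-1)%:E * \sum_i (f i x * (r i x - 1) ^+ 2)%:E))).
  apply: ae_ge0_le_integral => //.
  - by move=> x _; rewrite lee_fin sqr_ge0.
  - by apply/measurable_EFinP; exact: measurable_sqB.
  - by move=> x _; rewrite mule_ge0// sume_ge0.
  apply: filterS2 phi_ae sum_density_unif_mixture => x hx fx _.
  rewrite sumEFin -EFinM lee_fin ler_pdivlMl//; apply: weighted_sq_le => //.
  under eq_bigr => i _ do rewrite mulrBr mulr1 mulrC -hx.
  by rewrite sumrB fx sumr_const card_ord mulrBr mulr1 mulr_natl.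
rewrite ge0_integralZl//; last 2 first.
- by apply: emeasurable_sum => i; exact/measurable_EFinP.
- by move=> x _; exact: sume_ge0.
rewrite ge0_integral_sum//; last by move=> i; exact/measurable_EFinP.
apply: (@le_trans _ _ ((m.+1%:R^-1)%:E * \sum_(i < m.+1) D%:E)).
  by rewrite lee_wpmul2l// lee_sum.
by rewrite sumEFin sumr_const card_ord -EFinM lee_fin -[(D *+ _)%R]mulr_natl mulKf// pnatr_eq0.
Qed.

End chi2_mixture.

(** * The capacity dominates the average over a uniform prior *)

Section capacity.
Context d (T : measurableType d) (R : realType) (F : set (probability T R)) (m : nat).
Variable P : 'I_m.+1 -> probability T R.
Hypothesis FP : forall i, F (P i).
Let Q : probability T R := unif_mixture (ord0 : 'I_m.+1) P.
Variable f : 'I_m.+1 -> T -> R.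
Hypothesis Pf : forall i, has_density (P i) Q (f i).

Lemma ge0_integral_unif_mixture d' (S : measurableType d') (mu : 'I_m.+1 -> probability S R)
    (h : S -> \bar R) :
  measurable_fun [set: S] h -> (forall x, 0 <= h x) ->
  \int[unif_mixture (ord0 : 'I_m.+1) mu]_x h x =
  (m.+1%:R^-1)%:E * \sum_i \int[mu i]_x h x.
Proof.
move=> mh h0.
have c0 : (0 <= m.+1%:R^-1 :> R)%R by rewrite invr_ge0.
pose mu' k : {measure set S -> \bar R} := mu (inord k).
rewrite (eq_measure_integral (mscale (NngNum c0) (msum mu' m.+1))); last first.
  move=> A mA _; rewrite /mscale/= /msum /unif_mixture card_ord; congr (_ * _).
  by apply: eq_bigr => i _; rewrite /mu' inord_val.
rewrite ge0_integral_mscale//= ge0_integral_measure_sum//; congr (_ * _).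
by apply: eq_bigr => i _; rewrite /mu' inord_val.
Qed.

(* The uniform prior on the [P i] is carried by [nat], whose sigma-algebra is
   discrete. *)
Let rho : probability nat R :=
  unif_mixture (ord0 : 'I_m.+1) (fun i : 'I_m.+1 => \d_(i : nat) : probability nat R).
(** [inord] sends integers beyond [m] to index 0, so [k] stays in the family everywhere; [rho] does
    not charge them. *)
Let k (t : nat) : pprobability T R := P (inord t).
Let mk : measurable_fun [set: nat] k.
Proof. by []. Qed.

Let integral_rho (h : nat -> \bar R) : (forall x, 0 <= h x) ->
  \int[rho]_t h t = (m.+1%:R^-1)%:E * \sum_(i < m.+1) h i.
Proof.
move=> h0; rewrite ge0_integral_unif_mixture//; congr (_ * _).
by apply: eq_bigr => i _; rewrite integral_dirac// diracT mul1e.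
Qed.

Let mixtureE A : measurable A -> mixture rho mk A = Q A.
Proof.
move=> mA; rewrite /mixture integral_rho//.
rewrite [RHS](_ : _ = (#|'I_m.+1|%:R^-1)%:E * \sum_i P i A)//.
rewrite card_ord; congr (_ * _); apply: eq_bigr => i _.
by rewrite /kprobability/= /k inord_val.
Qed.

Let chi2E t : chi2 (k t : probability T R) (mixture rho mk) =
  \int[Q]_x ((f (inord t) x - 1) ^+ 2)%:E.
Proof.
have hd : has_density (k t : probability T R) (mixture rho mk) (f (inord t)).
  have [mf f0 fE] := Pf (inord t); split => // A mA.
  rewrite [LHS](fE A mA); apply: eq_measure_integral => B mB _.
  by rewrite [RHS]mixtureE.
rewrite /chi2 (int_sqdiff_density hd (has_density1 _)).
by apply: eq_measure_integral => B mB _; rewrite [LHS]mixtureE.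
Qed.

Lemma chi2_capacity_ge :
  (m.+1%:R^-1)%:E * \sum_i \int[Q]_x ((f i x - 1) ^+ 2)%:E <= chi2_capacity F.
Proof.
apply: ereal_sup_ubound; exists _, nat, rho, k, mk; split => //.
- by move=> t; exact: FP.
under eq_integral do rewrite chi2E.
rewrite integral_rho.
  by congr (_ * _); apply: eq_bigr => i _; rewrite inord_val.
by move=> t; apply: integral_ge0 => x _; rewrite lee_fin sqr_ge0.
Qed.

End capacity.

(** Here [x] stands for the infimum of the affinities 1 - H^2 / 2, so the base is e / x^2. At x = 0
    the base is infinite: the power is +oo, except for a zero exponent, where 0 times +oo is 0 and
    the power is 1. *)
Lemma epow_growth_ge (R : realType) (x C : R) (Cap : \bar R) :
  (0 <= x <= 1)%R -> (0 <= C)%R -> C%:E <= Cap ->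
  let growth := epow ((expR 1)%:E * (x%:E^-1 ^+ 2)) (3%:E * Cap) in
  [/\ 1 <= growth,
      (0 < x)%R -> (expR (3 * C * (1 - ln (x ^+ 2))))%:E <= growth &
      x = 0%R -> (0 < C)%R -> growth = +oo].
Proof.
move=> /andP[x0 x1] C0 Cle growth.
have Cap0 : 0 <= Cap by apply: le_trans Cle; rewrite lee_fin.
have Cap3 : 0 <= 3%:E * Cap by rewrite mule_ge0.
have e0 : (0 < expR 1 :> R)%R by exact: expR_gt0.
have [xz|xn0] := eqVneq x 0%R.
  have gE : growth = expeR (3%:E * Cap * +oo).
    rewrite /growth /epow xz inve0; congr (expeR (_ * _)).
    by rewrite expe2 mulyy gt0_muley ?lte_fin.
  split.
  - by rewrite gE -expeR0 lee_expeR mule_ge0.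
  - by rewrite xz ltxx.
  - move=> _ C1; rewrite gE gt0_muley//= mule_gt0//.
    by apply: lt_le_trans Cle; rewrite lte_fin.
have xgt0 : (0 < x)%R by rewrite lt_neqAle eq_sym xn0.
have x2 : (0 < x ^+ 2)%R by rewrite exprn_gt0.
have lnx : (ln (x ^+ 2) <= 0)%R by rewrite ln_le0// expr_le1.
have gE : growth = expeR (3%:E * Cap * (1 - ln (x ^+ 2))%:E).
  rewrite /growth /epow inver (negbTE xn0) expe2 -!EFinM lne_EFin; last first.
    by rewrite mulr_gt0// mulr_gt0 ?invr_gt0.
  congr (expeR (_ * _%:E)).
  rewrite -expr2 lnM ?posrE// ?exprn_gt0 ?invr_gt0//.
  by rewrite expRK exprVn lnV.
have s0 : (0 <= 1 - ln (x ^+ 2))%R by lra.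
split.
- by rewrite gE -expeR0 lee_expeR mule_ge0// lee_fin.
- move=> _; rewrite gE -[leLHS]/(expeR (3 * C * (1 - ln (x ^+ 2)))%:E) lee_expeR.
  by rewrite !EFinM lee_wpmul2r ?lee_fin// lee_wpmul2l.
- by move=> x_eq0; rewrite x_eq0 eqxx in xn0.
Qed.

(** * Hellinger affinity and inner products of densities *)

Section L2_facts.
Context d (T : measurableType d) (R : realType) (Q : probability T R).
Implicit Types f g : T -> R.

Lemma integral_sqint_mul f g : sqint Q f -> sqint Q g ->
  \int[Q]_x (f x * g x)%:E = (dotL2 Q f g)%:E.
Proof.
move=> hf hg; rewrite /dotL2 /Rintegral fineK//.
by apply: integrable_fin_num => //; exact: sqint_mul.
Qed.

Lemma integral_sqint_sq f : sqint Q f -> \int[Q]_x (f x ^+ 2)%:E = (dotL2 Q f f)%:E.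
Proof. by move=> hf; rewrite -integral_sqint_mul. Qed.

Lemma sqint_of_integral f : measurable_fun [set: T] f ->
  \int[Q]_x (f x ^+ 2)%:E < +oo -> sqint Q f.
Proof.
move=> mf h; split => //; apply/integrableP; split.
  by apply/measurable_EFinP; exact: measurable_funX.
by under eq_integral do rewrite gee0_abs ?lee_fin ?sqr_ge0//.
Qed.

Lemma sqint_norm f : sqint Q f -> sqint Q (fun x => `|f x|%R).
Proof.
move=> [mf if2]; split; first exact: measurableT_comp.
rewrite (_ : _ \o _ = EFin \o (fun x => f x ^+ 2)%R)//.
by apply/funext => x /=; rewrite real_normK ?num_real.
Qed.

Lemma dotL2_density1 (P : probability T R) f : has_density P Q f -> dotL2 Q f (cst 1%R) = 1%R.
Proof.
move=> [mf f0 fE]; rewrite /dotL2 (@eq_Rintegral _ _ _ Q setT f) => [|x _]; last first.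
  by rewrite mulr1.
rewrite /Rintegral -(fE _ measurableT).
by rewrite [X in fine X](_ : _ = 1%E)//; exact: probability_setT.
Qed.

Lemma sqint_sqrt_density (P : probability T R) f : has_density P Q f ->
  sqint Q (fun x => Num.sqrt (f x)).
Proof.
move=> Pf; have [mf f0 fE] := Pf; split.
  by apply: measurableT_comp => //; exact: measurable_sqrtr.
rewrite (_ : _ \o _ = EFin \o f); first exact: has_density_integrable Pf.
by apply/funext => x /=; rewrite sqr_sqrtr.
Qed.

Lemma hellinger2_affinity (P P' : probability T R) f g :
  has_density P Q f -> has_density P' Q g ->
  let r := dotL2 Q (fun x => Num.sqrt (f x)) (fun x => Num.sqrt (g x)) in
  hellinger2 P P' = (2 - 2 * r)%:E /\ (0 <= r)%R.
Proof.
move=> Pf Pg r; have hf := sqint_sqrt_density Pf; have hg := sqint_sqrt_density Pg.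
split; last by apply: Rintegral_ge0 => x _; rewrite mulr_ge0 ?sqrtr_ge0.
rewrite (hellinger2_density Pf Pg).
rewrite (@integral_sqint_sq ((fun x => Num.sqrt (f x)) \- (fun x => Num.sqrt (g x)))%R).
  have sq1 (P1 : probability T R) f1 : has_density P1 Q f1 ->
      dotL2 Q (fun x => Num.sqrt (f1 x)) (fun x => Num.sqrt (f1 x)) = 1%R.
    move=> Pf1; rewrite -(dotL2_density1 Pf1); apply: eq_Rintegral => x _.
    by rewrite -expr2 mulr1 sqr_sqrtr//; have [_ + _] := Pf1; apply.
  congr EFin; rewrite dotL2Br//; last exact: sqintB.
  rewrite !(dotL2C _ (_ \- _)%R) !dotL2Br// !(sq1 _ _ Pf, sq1 _ _ Pg).
  by rewrite (dotL2C _ (fun x => Num.sqrt (g x))) -/r; ring.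
exact: sqintB.
Qed.

(** Cauchy-Schwarz for sqrt(f g) against the constant 1, which has norm 1. *)
Lemma affinity_sq_le (P P' : probability T R) f g :
  has_density P Q f -> has_density P' Q g -> sqint Q f -> sqint Q g ->
  (dotL2 Q (fun x => Num.sqrt (f x)) (fun x => Num.sqrt (g x)) ^+ 2 <= dotL2 Q f g)%R.
Proof.
move=> Pf Pg hf hg; have [mf f0 _] := Pf; have [mg g0 _] := Pg.
pose h x := (Num.sqrt (f x) * Num.sqrt (g x))%R.
have h2 x : (h x ^+ 2 = f x * g x)%R by rewrite exprMn !sqr_sqrtr.
have hh : sqint Q h.
  split.
    by apply: measurable_funM; apply: measurableT_comp => //; exact: measurable_sqrtr.
  rewrite (_ : _ \o _ = EFin \o (f \* g)%R); first exact: sqint_mul.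
  by apply/funext => x /=; rewrite h2.
have c1 := sqint_cst Q 1%R.
have := dotL2_CS hh c1.
have -> : dotL2 Q (cst 1%R) (cst 1%R) = 1%R.
  exact: (dotL2_density1 (has_density1 Q)).
rewrite mulr1.
have -> : dotL2 Q h (cst 1%R) = dotL2 Q (fun x => Num.sqrt (f x)) (fun x => Num.sqrt (g x)).
  by apply: eq_Rintegral => x _; rewrite mulr1.
by congr (_ <= _)%R; apply: eq_Rintegral => x _; rewrite -expr2 h2.
Qed.

End L2_facts.

Section norm_expansion.
Context d (T : measurableType d) (R : realType) (Q : probability T R).
Implicit Types f g : T -> R.

Lemma dotL2_normB f g : sqint Q f -> sqint Q g ->
  dotL2 Q (f \- g)%R (f \- g)%R = (dotL2 Q f f - 2 * dotL2 Q f g + dotL2 Q g g)%R.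
Proof.
move=> hf hg; have hB := sqintB hf hg.
have e1 : dotL2 Q (f \- g)%R f = (dotL2 Q f f - dotL2 Q f g)%R.
  by rewrite dotL2C dotL2Br.
have e2 : dotL2 Q (f \- g)%R g = (dotL2 Q f g - dotL2 Q g g)%R.
  by rewrite dotL2C dotL2Br// (dotL2C Q g f).
by rewrite dotL2Br// e1 e2; ring.
Qed.

Lemma dotL2_normD f g : sqint Q f -> sqint Q g ->
  dotL2 Q (f \+ g)%R (f \+ g)%R = (dotL2 Q f f + 2 * dotL2 Q f g + dotL2 Q g g)%R.
Proof.
move=> hf hg; have hD := sqintD hf hg.
have e1 : dotL2 Q (f \+ g)%R f = (dotL2 Q f f + dotL2 Q f g)%R.
  by rewrite dotL2C dotL2Dr.
have e2 : dotL2 Q (f \+ g)%R g = (dotL2 Q f g + dotL2 Q g g)%R.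
  by rewrite dotL2C dotL2Dr// (dotL2C Q g f).
by rewrite dotL2Dr// e1 e2; ring.
Qed.

End norm_expansion.

(** * The family, its parameters and the resulting bounds *)

Section setup.
Context d (T : measurableType d) (R : realType) (F : set (probability T R)) (n : nat).
Variables (P : 'I_n.+2 -> probability T R) (P0' : probability T R).
Hypothesis D_fin : chi2_diameter F < +oo.
Hypothesis FP : forall i, F (P i).
Hypothesis FP0' : F P0'.

Let Q : probability T R := unif_mixture (ord0 : 'I_n.+1) (fun i => P (lift ord0 i)).

Lemma chi2_ge0 (P1 P2 : probability T R) : 0 <= chi2 P1 P2.
Proof.
have [fin|] := ltP (chi2 P1 P2) +oo; last by apply: le_trans.
have [r hr] := dominates_has_density (chi2_dominates fin).
rewrite /chi2 (int_sqdiff_density hr (has_density1 _)).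
by apply: integral_ge0 => y _; rewrite lee_fin sqr_ge0.
Qed.

Let D : R := fine (chi2_diameter F).

Let D_E : chi2_diameter F = D%:E.
Proof.
rewrite fineK// ge0_fin_numE//.
apply: le_trans (chi2_ge0 P0' P0') _; apply: ereal_sup_ubound.
by exists P0' => //; exists P0'.
Qed.

Let chi2_le P1 P2 : F P1 -> F P2 -> chi2 P1 P2 <= D%:E.
Proof.
by move=> F1 F2; rewrite -D_E; apply: ereal_sup_ubound; exists P1 => //; exists P2.
Qed.

Let D_ge0 : (0 <= D)%R.
Proof. by rewrite -lee_fin (le_trans (chi2_ge0 P0' P0'))// chi2_le. Qed.

(** Finite divergence makes [P1] dominated by one component of the mixture, and each component is
    dominated by the mixture. *)
Lemma family_density P1 : F P1 -> exists f, has_density P1 Q f.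
Proof.
move=> F1; apply: dominates_has_density.
have h1 : P1 `<< P (lift ord0 ord0).
  by apply: chi2_dominates; apply: le_lt_trans (chi2_le F1 (FP _)) (ltry _).
exact: (null_dominates_trans h1
  (@unif_mixture_dominates _ _ _ _ (fun i => P (lift ord0 i)) ord0)).
Qed.

Variables (f : 'I_n.+2 -> T -> R) (f0' : T -> R).
Hypothesis Pf : forall i, has_density (P i) Q (f i).
Hypothesis Pf0' : has_density P0' Q f0'.

Let sqint1 P1 h : F P1 -> has_density P1 Q h ->
  sqint Q (h \- cst 1%R)%R /\ (dotL2 Q (h \- cst 1) (h \- cst 1) <= D)%R.
Proof.
move=> F1 hd; have [mh _ _] := hd.
have le := @chi2_unif_mixture_le _ _ _ n (fun i => P (lift ord0 i)) _
  (fun i => Pf (lift ord0 i)) P1 h D (fun i => chi2_le F1 (FP _)) hd.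
have hs : sqint Q (h \- cst 1%R)%R.
  apply: sqint_of_integral; first exact: measurable_funB.
  exact: le_lt_trans le (ltry _).
by split => //; rewrite -lee_fin -integral_sqint_sq.
Qed.

Let sqintP P1 h : F P1 -> has_density P1 Q h -> sqint Q h.
Proof.
move=> F1 /(sqint1 F1)[hs _].
rewrite (_ : h = ((h \- cst 1) \+ cst 1)%R); first exact/sqintD/sqint_cst.
by apply/funext => x /=; rewrite subrK.
Qed.

Let fS i := f (lift ord0 i).
Let g : T -> R := (f ord0 \- f0')%R.
Let hf i : sqint Q (f i). Proof. exact: sqintP (Pf i). Qed.
Let hf0' : sqint Q f0'. Proof. exact: sqintP Pf0'. Qed.
Let hg : sqint Q g. Proof. exact: sqintB. Qed.
Let h1 : sqint Q (cst 1%R). Proof. exact: sqint_cst. Qed.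

(** Write g as a - b with a and b the centred densities, both of squared norm at most D; the
    parallelogram identity gives |g|^2 <= 2 |a|^2 + 2 |b|^2. *)
Let normg_le : (dotL2 Q g g <= 4 * D)%R.
Proof.
have [s0 l0] := sqint1 (FP ord0) (Pf ord0); have [s0' l0'] := sqint1 FP0' Pf0'.
set a := (f ord0 \- cst 1)%R in s0 l0; set b := (f0' \- cst 1)%R in s0' l0'.
have gE : g = (a \- b)%R by apply/funext => x; rewrite /g /a /b /=; ring.
have := dotL2_ge0 Q (a \+ b)%R; rewrite gE.
by rewrite dotL2_normB// dotL2_normD//; lra.
Qed.

Let C : R := (n.+1%:R^-1 * \sum_i (dotL2 Q (fS i) (fS i) - 1))%R.

Let dot_sub1 i : (dotL2 Q (fS i) (fS i) - 1 =
  dotL2 Q (fS i \- cst 1) (fS i \- cst 1))%R.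
Proof.
rewrite dotL2_normB// ?(dotL2_density1 (Pf (lift ord0 i))); last exact: hf.
by rewrite (dotL2_density1 (has_density1 Q)); ring.
Qed.

Let C_ge0 : (0 <= C)%R.
Proof.
rewrite mulr_ge0 ?invr_ge0// sumr_ge0// => i _.
by rewrite dot_sub1 dotL2_ge0.
Qed.

(** This makes [D] positive when [C] is, so that an infinite growth factor gives an infinite
    right-hand side. *)
Let C_le_D : (C <= D)%R.
Proof.
rewrite /C ler_pdivrMl// mulr_natl -[in leRHS](card_ord n.+1) -sumr_const.
by apply: ler_sum => i _; rewrite dot_sub1; have [] := sqint1 (FP _) (Pf (lift ord0 i)).
Qed.

Let C_le_capacity : C%:E <= chi2_capacity F.
Proof.
have := @chi2_capacity_ge _ _ _ F n (fun i => P (lift ord0 i)) (fun i => FP _) fS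
  (fun i => Pf (lift ord0 i)).
apply: le_trans; rewrite /C EFinM -sumEFin le_eqVlt; apply/orP; left; apply/eqP.
congr (_ * _); apply: eq_bigr => i _; rewrite dot_sub1.
by rewrite -integral_sqint_sq//; exact: (sqintB (hf _) h1).
Qed.

Let h := ereal_sup [set hellinger2 P1 P2 | P1 in F & P2 in F].

Let h_ge i j : hellinger2 (P i) (P j) <= h.
Proof. by apply: ereal_sup_ubound; exists (P i) => //; exists (P j). Qed.

Let x : R := (1 - 2^-1 * fine h)%R.

Let h_fin : h = (fine h)%:E /\ (0 <= fine h <= 2)%R.
Proof.
have le2 : h <= 2%:E.
  apply: ge_ereal_sup => _ [P1 F1 [P2 F2 <-]].
  have [f1 d1] := family_density F1; have [f2 d2] := family_density F2.
  have [-> r0] := hellinger2_affinity d1 d2.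
  by rewrite lee_fin lerBlDr lerDl mulr_ge0.
have ge0 : 0 <= h.
  apply: le_trans (h_ge ord0 ord0).
  by rewrite /hellinger2; apply: integral_ge0 => y _; rewrite lee_fin sqr_ge0.
have hfin : h \is a fin_num.
  by rewrite ge0_fin_numE// (le_lt_trans le2)// ltry.
by rewrite fineK//; split => //; rewrite -!lee_fin fineK// ge0.
Qed.

Let x01 : (0 <= x <= 1)%R.
Proof. by have [_ /andP[h0 h2]] := h_fin; rewrite /x; lra. Qed.

Let growth := epow ((expR 1)%:E * hellinger_delta F) (3%:E * chi2_capacity F).

Let growth_ge : [/\ 1 <= growth,
  (0 < x)%R -> (expR (3 * C * (1 - ln (x ^+ 2))))%:E <= growth &
  x = 0%R -> (0 < C)%R -> growth = +oo].
Proof.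
have -> : growth = epow ((expR 1)%:E * (x%:E^-1 ^+ 2)) (3%:E * chi2_capacity F).
  rewrite /growth /hellinger_delta -/h; have [-> _] := h_fin.
  by rewrite -EFinM -EFinB.
exact: epow_growth_ge x01 C_ge0 C_le_capacity.
Qed.

Let A i j := dotL2 Q (ordcons g fS i) (ordcons g fS j).

Let permA_le eps : (0 < eps <= 1)%R ->
  (forall i j, i != j -> eps <= dotL2 Q (fS i) (fS j))%R ->
  (Fock.permanent A <= dotL2 Q g g * (n.+1`!)%:R * expR (3 * C * (1 - ln eps)))%R.
Proof.
move=> /andP[eps0 eps1] epsP; apply: permanent_L2_le => //.
- by move=> i; exact: hf.
- rewrite dotL2C dotL2Br// !(dotL2C Q (cst 1%R)).
  by rewrite (dotL2_density1 (Pf ord0)) (dotL2_density1 Pf0') subrr.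
- by move=> i; exact: dotL2_density1 (Pf _).
- exact: sum_density_unif_mixture (fun i => Pf (lift ord0 i)).
Qed.

Let x_sq_le i j : (x ^+ 2 <= dotL2 Q (fS i) (fS j))%R.
Proof.
apply: le_trans (affinity_sq_le (Pf _) (Pf _) (hf _) (hf _)).
have [hE r0] := hellinger2_affinity (Pf (lift ord0 i)) (Pf (lift ord0 j)).
have := h_ge (lift ord0 i) (lift ord0 j); have [-> _] := h_fin; rewrite hE lee_fin => le.
have /andP[x0 _] := x01.
by rewrite ler_sqr ?nnegrE// /x; lra.
Qed.

(** When C = 0 every density is 1 in L^2, so [eps] can be taken to be 1 even if the affinities of
    the whole family come close to 0. *)
Let C0_dot : C = 0%R -> forall i j, (1 <= dotL2 Q (fS i) (fS j))%R.
Proof.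
move=> /eqP; rewrite mulf_eq0 invr_eq0 pnatr_eq0/= psumr_eq0; last first.
  by move=> i _; rewrite dot_sub1 dotL2_ge0.
move=> /allP z i j.
have zi k : dotL2 Q (fS k \- cst 1)%R (fS k \- cst 1)%R = 0%R.
  by rewrite -dot_sub1; apply/eqP; apply: (implyP (z k _)) => //; rewrite mem_index_enum.
have si k : sqint Q (fS k \- cst 1)%R by exact: sqintB (hf _) h1.
have := dotL2_CS (si i) (si j); rewrite zi mul0r => le0.
have /eqP : (dotL2 Q (fS i \- cst 1) (fS j \- cst 1) ^+ 2 == 0)%R.
  by rewrite eq_le le0 sqr_ge0.
move=> /eqP; rewrite sqrf_eq0 => /eqP.
rewrite dotL2Br//; last exact: hf.
rewrite !(dotL2C Q (fS i \- cst 1)%R) !dotL2Br//; try exact: hf.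
rewrite (dotL2C Q (cst 1%R) (fS i)) !(dotL2_density1 (Pf (lift ord0 _))).
by rewrite (dotL2_density1 (has_density1 Q)) (dotL2C Q (fS j)); lra.
Qed.

Let X : R := ((n.+2`!)%:R^-1 * Fock.permanent A)%R.

(** The factor 1 / n of the theorem is the ratio of (n + 1)! in the permanent bound to the (n + 2)!
    of the average over permutations. *)
Let X_le kappa : (0 <= kappa)%R ->
  (Fock.permanent A <= dotL2 Q g g * (n.+1`!)%:R * kappa)%R ->
  (X <= 4 * D * kappa * n.+2%:R^-1)%R.
Proof.
move=> k0 le; have fgt0 : (0 < (n.+1`!)%:R :> R)%R by rewrite ltr0n fact_gt0.
rewrite /X factS natrM invfM -[leLHS]mulrA [leRHS]mulrC ler_wpM2l ?invr_ge0//.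
rewrite ler_pdivrMl//; apply: (le_trans le); rewrite mulrAC [leRHS]mulrC.
by apply: ler_wpM2r; [exact: ltW|exact: ler_wpM2r].
Qed.

(** Three cases: for C = 0 take eps = 1 and growth >= 1; for C > 0 and x = 0 the right side is +oo;
    otherwise eps = x^2 is admissible by [x_sq_le]. *)
Lemma gram_permanent_bound :
  X%:E <= 12%:E * chi2_diameter F * growth * (n.+2%:R^-1)%:E.
Proof.
have [g1 gx gy] := growth_ge; have /andP[x0 x1] := x01; rewrite D_E.
have Xk kappa : (0 <= kappa)%R -> kappa%:E <= growth ->
    (Fock.permanent A <= dotL2 Q g g * (n.+1`!)%:R * kappa)%R ->
    X%:E <= 12%:E * D%:E * growth * (n.+2%:R^-1)%:E.
  move=> k0 kg /(X_le k0) le.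
  (* The estimate holds with 4 D and is relaxed here to 12 D. *)
  apply: (@le_trans _ _ (12%:E * D%:E * kappa%:E * (n.+2%:R^-1)%:E)).
    rewrite -!EFinM lee_fin (le_trans le)// ler_wpM2r ?invr_ge0// ler_wpM2r//.
    by rewrite ler_wpM2r// ler_nat.
  by rewrite lee_wpmul2r ?lee_fin ?invr_ge0// lee_wpmul2l// -EFinM lee_fin mulr_ge0.
have [C0|Cn0] := eqVneq C 0%R.
  apply: (Xk 1%R) => //.
  have := @permA_le 1%R; rewrite ltr01 lexx C0 mulr0 mul0r expR0; apply => //.
  by move=> i j _; exact: C0_dot.
have Cgt0 : (0 < C)%R by rewrite lt_neqAle eq_sym Cn0.
have [xz|xn0] := eqVneq x 0%R.
  have D12 : 0 < 12%:E * D%:E.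
    by rewrite -EFinM lte_fin mulr_gt0// (lt_le_trans Cgt0).
  have n2 : 0 < (n.+2%:R^-1 : R)%:E by rewrite lte_fin invr_gt0.
  by rewrite (gy xz Cgt0) gt0_muley// gt0_mulye// leey.
have xgt0 : (0 < x)%R by rewrite lt_neqAle eq_sym xn0.
apply: Xk (gx xgt0) _; first exact: expR_ge0.
apply: permA_le; first by rewrite exprn_gt0// expr_le1.
by move=> i j _; exact: x_sq_le.
Qed.

Let f' (i : 'I_n.+2) := if i == ord0 then f0' else f i.
Let P' (i : 'I_n.+2) := if i == ord0 then P0' else P i.
Let Qn : probability (n.+2.-tuple T) R := tuple_product (fun=> Q).

Let Pf' i : has_density (P' i) Q (f' i).
Proof. by rewrite /P' /f'; case: ifP. Qed.

Let hf' i : sqint Q (f' i). Proof. by rewrite /f'; case: ifP. Qed.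

Let psi := permavg (ordcons g fS).

Let sq_psi : sqint Qn psi.
Proof. by apply: sqint_permavg => i; exact: (sqint_ordcons hg (fun i => hf (lift ord0 i))). Qed.

Let psiE t : (permavg f t - permavg f' t = psi t)%R.
Proof. exact: permavgB. Qed.

Let dens := has_density_perm_mixture Pf.
Let dens' := has_density_perm_mixture Pf'.

Let dotpsi : dotL2 Qn psi psi = X.
Proof. by rewrite /psi dotL2_permavg// => i; exact: (sqint_ordcons hg (fun i => hf (lift ord0 i))). Qed.

Lemma int_sqdiff_perm_mixture :
  int_sqdiff (perm_mixture P) (perm_mixture P') Qn = X%:E.
Proof.
rewrite (int_sqdiff_density dens dens') -dotpsi -integral_sqint_sq//.
by apply: eq_integral => t _; rewrite psiE.
Qed.

(** Cauchy-Schwarz for |psi| against the constant 1; the quarter is the square of the half in the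
    total variation. *)
Lemma TV_perm_mixture_le :
  TV (perm_mixture P) (perm_mixture P') ^+ 2 <= 4^-1%:E * X%:E.
Proof.
rewrite (TV_density dens dens').
have sn := sqint_norm sq_psi; have s1 := sqint_cst Qn 1%R.
have -> : \int[Qn]_t `|permavg f t - permavg f' t|%:E =
    (dotL2 Qn (fun t => `|psi t|%R) (cst 1%R))%:E.
  rewrite -integral_sqint_mul//; apply: eq_integral => t _.
  by rewrite psiE mulr1.
have := dotL2_CS sn s1; rewrite (dotL2_density1 (has_density1 Qn)) mulr1.
have -> : dotL2 Qn (fun t => `|psi t|%R) (fun t => `|psi t|%R) = X.
  rewrite -dotpsi; apply: eq_Rintegral => t _.
  by rewrite -!expr2 real_normK ?num_real.
rewrite expe2 -!EFinM lee_fin; lra.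
Qed.

Lemma expectation_sq_diff_le (u : n.+2.-tuple T -> R) : u \in Lfun Qn 2%:E ->
  ('E_(perm_mixture P)[u] - 'E_(perm_mixture P')[u]) ^+ 2 <=
  'E_Qn[fun t => (u t ^+ 2)%R] * X%:E.
Proof.
move=> uL.
have su : sqint Qn u.
  split; last exact: Lfun2_integrable_sqr.
  by move: uL; rewrite inE => /andP[+ _]; rewrite inE.
have mu' : measurable_fun [set: n.+2.-tuple T] (EFin \o u).
  by apply/measurable_EFinP; have [] := su.
have sp : sqint Qn (permavg f) by exact: sqint_permavg.
have sp' : sqint Qn (permavg f') by exact: sqint_permavg.
have E1 : 'E_(perm_mixture P)[u] = (dotL2 Qn u (permavg f))%:E.
  rewrite unlock (integral_density dens mu') -integral_sqint_mul//.
have E2 : 'E_(perm_mixture P')[u] = (dotL2 Qn u (permavg f'))%:E.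
  rewrite unlock (integral_density dens' mu') -integral_sqint_mul//.
have E3 : 'E_Qn[fun t => (u t ^+ 2)%R] = (dotL2 Qn u u)%:E.
  by rewrite unlock integral_sqint_sq.
rewrite E1 E2 E3 -EFinB expe2 -!EFinM lee_fin -expr2 -dotL2Br//.
have -> : dotL2 Qn u (permavg f \- permavg f')%R = dotL2 Qn u psi.
  by apply: eq_Rintegral => t _ /=; rewrite psiE.
by rewrite -dotpsi; exact: dotL2_CS.
Qed.

End setup.

Theorem theorem1p5 (R : realType) (d : measure_display) (T : measurableType d)
    (F : set (probability T R)) (n : nat) (P : 'I_n.+2 -> probability T R)
    (P0' : probability T R) :
  chi2_diameter F < +oo ->
  (forall i, F (P i)) ->
  F P0' ->
  let P' := fun i : 'I_n.+2 => if i == ord0 then P0' else P i in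
  let Pn : probability (n.+2.-tuple T) R := perm_mixture P in
  let Pn' : probability (n.+2.-tuple T) R := perm_mixture P' in
  let Pbar : probability T R :=
    unif_mixture (ord0 : 'I_n.+1) (fun i : 'I_n.+1 => P (lift ord0 i)) in
  let Pbarn : probability (n.+2.-tuple T) R :=
    tuple_product (fun _ : 'I_n.+2 => Pbar) in
  let growth := epow ((expR 1)%:E * hellinger_delta F)
                     (3%:E * chi2_capacity F) in
  [/\ TV Pn Pn' ^+ 2 <= 4^-1%:E * int_sqdiff Pn Pn' Pbarn,
      4^-1%:E * int_sqdiff Pn Pn' Pbarn
        <= 3%:E * chi2_diameter F * growth * (n.+2%:R^-1)%:E &
      forall f : n.+2.-tuple T -> R, f \in Lfun Pbarn 2%:E ->
        ('E_Pn[f] - 'E_Pn'[f]) ^+ 2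
          <= 'E_Pbarn[fun t => (f t ^+ 2)%R] *
             (12%:E * chi2_diameter F * growth * (n.+2%:R^-1)%:E)].
Proof.
move=> D_fin FP FP0' P' Pn Pn' Pbar Pbarn growth.
have /choice[f Pf] i := family_density D_fin FP FP0' (FP i).
have [f0' Pf0'] := family_density D_fin FP FP0' FP0'.
have X_le := gram_permanent_bound D_fin FP FP0' Pf Pf0'.
have XE := int_sqdiff_perm_mixture D_fin FP FP0' Pf Pf0'.
split.
- rewrite [int_sqdiff _ _ _]XE; exact: (TV_perm_mixture_le D_fin FP FP0' Pf Pf0').
- rewrite [int_sqdiff _ _ _]XE.
  (* The claim is a quarter of [gram_permanent_bound]. *)
  rewrite (_ : 3%:E = 4^-1%:E * 12%:E).
    rewrite -!muleA; apply: lee_wpmul2l; first by rewrite lee_fin invr_ge0.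
    by rewrite !muleA.
  by rewrite -EFinM; congr EFin; field.
- move=> u uL.
  apply: le_trans (expectation_sq_diff_le D_fin FP FP0' Pf Pf0' uL) _.
  apply: lee_wpmul2l => //.
  by rewrite unlock; apply: integral_ge0 => t _; rewrite lee_fin sqr_ge0.
Qed.
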